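(* Let $E$ be a Banach space and let $B_w$ be its closed unit ball endowed with the weak topology of $E$. Then the following assertions are equivalent: (i) $B_w$ is an Ascoli space; (ii) $B_w$ is a $k_{\mathbb{R}}$-space; (iii) every sequentially continuous real-valued map on $B_w$ is continuous; (iv) $E$ does not contain an isomorphic copy of $\ell_1$.
   Context: For a topological space $Z$, $C_k(Z)$ denotes the space of all continuous functions $Z\to\mathbb{R}$ endowed with the compact-open topology. A subset $\mathcal{K}\subset C_k(Z)$ is evenly continuous if the evaluation map $(z,f)\mapsto f(z)$ restricted to $Z\times\mathcal{K}$ is jointly continuous, i.e. for every $z\in Z$, every $f\in\mathcal{K}$ and every neighborhood $O$ of $f(z)$ in $\mathbb{R}$ there are neighborhoods $U_f\subset\mathcal{K}$ of $f$ (in $\mathcal{K}$) and $O_z\subset Z$ of $z$ such that $g(y)\in O$ for all $g\in U_f$, $y\in O_z$. A Tychonoff space $Z$ is called an Ascoli space if every compact subset of $C_k(Z)$ is evenly continuous. A topological space $Z$ is a $k_{\mathbb{R}}$-space if a function $f:Z\to\mathbb{R}$ is continuous if and only if its restriction to each compact subset of $Z$ is continuous. An isomorphic copy of $\ell_1$ in $E$ is a linear subspace of $E$ linearly homeomorphic to $\ell_1$. *)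

(* Defs.v *)
From HB Require Import structures.
From mathcomp Require Import all_boot all_order all_algebra.
From mathcomp Require Import all_classical all_reals all_analysis.

Set Implicit Arguments.
Unset Strict Implicit.
Unset Printing Implicit Defensive.

Import Order.TTheory GRing.Theory Num.Theory.
Import numFieldNormedType.Exports.

Local Open Scope classical_set_scope.
Local Open Scope ring_scope.

Section spaces_of_continuous_functions.
Context {R : realType} {Z : topologicalType}.

(* As a type, a set carries the subspace topology of subtype_topology.v. *)
Definition Ck : set {compact-open, Z -> R} := [set f | continuous (f : Z -> R)].

Definition Ck_eval (zf : Z * Ck) : R := (set_val zf.2 : Z -> R) zf.1.

Definition evenly_continuous (K : set Ck) : Prop :=
  {within [set: Z] `*` K, continuous Ck_eval}.

Lemma evenly_continuousP (K : set Ck) :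
  evenly_continuous K <->
  forall (z : Z) (f : Ck), K f -> forall O : set R, nbhs (Ck_eval (z, f)) O ->
    exists U : set Ck, exists V : set Z, [/\ nbhs f U, nbhs z V &
      forall g y, (K `&` U) g -> V y -> O (Ck_eval (y, g))].
Proof.
rewrite /evenly_continuous subspace_continuousP; split.
  move=> cK z f Kf O /(cK (z, f) (conj I Kf)).
  move=> [[V U] /= [Vz Uf] VUO]; exists U, V; split => // g y [Kg Ug] Vy.
  exact: (VUO (y, g)).
move=> H [z f] [_ /= Kf] O /(H z f Kf)[U [V [Uf Vz UVO]]].
exists (V, U) => //= -[y g] /= [Vy Ug] [_ Kg]; exact: UVO.
Qed.

End spaces_of_continuous_functions.
Arguments Ck : clear implicits.

Definition tychonoff_space (Z : topologicalType) : Prop :=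
  completely_regular_space Z /\ hausdorff_space Z.

Definition ascoli_space (R : realType) (Z : topologicalType) : Prop :=
  tychonoff_space Z /\
  forall K : set (Ck R Z), compact K -> evenly_continuous K.

Definition kR_space (R : realType) (Z : topologicalType) : Prop :=
  forall f : Z -> R,
    continuous f <-> forall K : set Z, compact K -> {within K, continuous f}.

Definition seq_continuous (X Y : topologicalType) (f : X -> Y) : Prop :=
  forall (u : nat -> X) (x : X), u @ \oo --> x -> (f \o u) @ \oo --> f x.

Section weak_topology.
Context {R : realType} (E : normedModType R).

Definition dual : Type := {f : {linear E -> R^o} | continuous f}.

(* E with the coarsest topology making every element of the dual continuous;
   the norm topology stays the canonical one on E itself. *)
Definition weak_space : uniformType := @sup_topology E dual
  (fun f => Uniform.class (initial_topology (sval f : E -> R^o))).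

Definition unit_ball_w : set weak_space := [set x | `|x : E| <= 1].

Lemma cvg_weakP (F : set_system E) (x : E) : Filter F ->
  F --> (x : weak_space) <-> forall f : dual, sval f @ F --> sval f x.
Proof.
move=> FF; rewrite cvg_sup; split => Fx f.
- move=> A fxA; apply: (Fx f).
  by apply: (@initial_continuous _ _ (sval f : E -> R^o) x) => //.
- move=> A [_ [[B oB <-] Bfx] BA].
  by apply: filterS BA _; apply: (Fx f); exact: open_nbhs_nbhs.
Qed.

End weak_topology.
Arguments unit_ball_w {R} E _.

Section ell1.
Context (R : realType).
Implicit Types x y : nat -> R.

Definition ell1_pred : {pred nat -> R} :=
  mem [set x : nat -> R | cvgn [normed series x]].

Lemma ell1P x : x \in ell1_pred <-> cvgn [normed series x].
Proof. by rewrite inE. Qed.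

Lemma ell1_submod_closed : submod_closed ell1_pred.
Proof.
split=> [|a x y /ell1P cx /ell1P cy]; apply/ell1P.
  rewrite [X in cvgn X](_ : _ = cst 0); first exact: is_cvg_cst.
  by apply/funext => n /=; rewrite /series/= big1// => i _; rewrite normr0.
apply: (@series_le_cvg R _ (`|a| *: [sequence `|x n|]_n + [sequence `|y n|]_n)).
- by move=> n; exact: normr_ge0.
- by move=> n; exact: addr_ge0 (mulr_ge0 (normr_ge0 _) (normr_ge0 _)) (normr_ge0 _).
- by move=> n; rewrite (le_trans (ler_normD _ _))// lerD2r normrM.
- by apply: is_cvg_seriesD => //; exact: is_cvg_seriesZ.
Qed.

HB.instance Definition _ :=
  GRing.isSubmodClosed.Build R (nat -> R) ell1_pred ell1_submod_closed.

Record ell1 := Ell1 { ell1_val :> nat -> R ; _ : ell1_val \in ell1_pred }.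

HB.instance Definition _ := [isSub for ell1_val].
HB.instance Definition _ := [Choice of ell1 by <:].
HB.instance Definition _ := [SubChoice_isSubLmodule of ell1 by <:].

Lemma ell1_cvg (x : ell1) : cvgn [normed series x].
Proof. by apply/ell1P; exact: valP. Qed.
Arguments ell1_cvg : clear implicits.

Definition ell1_norm (x : ell1) : R := limn [normed series x].

Lemma ell1_normD (x y : ell1) : ell1_norm (x + y) <= ell1_norm x + ell1_norm y.
Proof.
have cx := ell1_cvg x; have cy := ell1_cvg y.
have cxy : cvgn (series ([sequence `|x n|]_n + [sequence `|y n|]_n)).
  exact: is_cvg_seriesD.
rewrite (_ : ell1_norm x + ell1_norm y =
    limn (series ([sequence `|x n|]_n + [sequence `|y n|]_n))); last first.
  by symmetry; exact: (lim_seriesD cx cy).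
apply: (lim_series_le (ell1_cvg (x + y)) cxy) => n; exact: ler_normD.
Qed.

Lemma ell1_normZ (a : R) (x : ell1) : ell1_norm (a *: x) = `|a| * ell1_norm x.
Proof.
rewrite [RHS](_ : _ = limn (series (`|a| *: [sequence `|x n|]_n))); last first.
  by symmetry; exact: (lim_seriesZ `|a| (ell1_cvg x)).
by congr (limn (series _)); apply/funext => n; rewrite /= normrM.
Qed.

Lemma ell1_norm_eq0 (x : ell1) : ell1_norm x = 0 -> x = 0.
Proof.
move=> x0; apply/val_inj/funext => n /=; apply/eqP.
rewrite -normr_le0 -[leRHS]x0.
have nd : nondecreasing_seq [normed series x].
  by apply: nondecreasing_series => i _ _; exact: normr_ge0.
apply: le_trans (nondecreasing_cvgn_le nd (ell1_cvg x) n.+1).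
by rewrite /= /series/= big_nat_recr//= lerDr sumr_ge0.
Qed.

HB.instance Definition _ :=
  Lmodule_isNormed.Build R ell1 ell1_normD ell1_normZ ell1_norm_eq0.

End ell1.
Arguments ell1_cvg {R} x.

(* a linear homeomorphism T of X onto the subspace range T of E *)
Definition contains_isomorphic_copy (R : realType) (X E : normedModType R) :
    Prop :=
  exists (T : {linear X -> E}) (S : E -> X),
    [/\ continuous T, cancel T S & {within range T, continuous S}].

(* Main.v *)
From HB Require Import structures.
Require Import Defs.
From mathcomp Require Import all_boot all_order all_algebra.
From mathcomp Require Import all_classical all_reals all_analysis.
From mathcomp Require Import lra.
Import Order.TTheory GRing.Theory Num.Theory.
Import numFieldNormedType.Exports.

Local Open Scope classical_set_scope.
Local Open Scope ring_scope.

Set Implicit Arguments.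
Unset Strict Implicit.
Unset Printing Implicit Defensive.

(* Suppose E contains no copy of l1 and x lies in the weak closure of a bounded
   set A. Compactness of the dual ball gives a countable subset (b n) of A with
   x in its weak closure, hence an ultrafilter U along which b tends weakly to x.
   For eps > 0, call a set D of functionals small if f (b n - x) <= eps holds
   simultaneously for all f in D and for U-many n. If for every eps the dual ball
   is a countable union of small sets, a diagonal choice gives a subsequence of b
   tending weakly to x. Otherwise, removing all the basic open sets that are
   countable unions of small sets leaves a kernel in which one picks
   inductively a subsequence on which the functionals realise all the patterns
   "> eps" / "< eps / 2"; such a subsequence of b - x is equivalent to the basis
   of l1. Hence B_w is Frechet-Urysohn, which implies (i), (ii) and (iii).
   The same dichotomy shows that weakly compact sets are Frechet-Urysohn in any E,
   since an l1-like sequence cannot live in one (double limit argument).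

   Conversely, let (e n) be equivalent to the basis of l1 and extend each sign
   sequence s to a bounded functional phi s with phi s (e n) = s n. Let m be an
   ultrafilter limit of uniform averages over sign sequences, and put
   q x = m |phi s x| and g n x = m (s n * phi s x). By Bessel g n -> 0 pointwise,
   and q is weakly sequentially continuous, because any sequence of sets of
   m-measure bounded below has a subsequence with the finite intersection
   property, and a weak* limit point is then a functional large on infinitely
   many terms. But 0 is in the weak closure of the vectors (e n - e k) / 2 with
   n < k, at which q = 1/2 and g k = -1/2. So q contradicts (ii) and (iii), and
   the compact set {g n} u {0} contradicts (i). *)

(** * A combinatorial dichotomy *)

Lemma exists_invS_le {R : realType} (e : R) :
  0 < e -> exists n : nat, n.+1%:R^-1 <= e.
Proof.
move=> e0; exists (Num.truncn e^-1); rewrite invf_ple ?posrE// ltW//.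
exact: truncnS_gt.
Qed.

(** Rosenthal's independence of the pairs of sets where [v _ i] exceeds [e] and where it is below
    [e / 2]. Only finite patterns are asked for; compactness of the dual ball later supplies the
    infinite ones. *)
Definition independent {R : realType} {X : Type} (v : X -> nat -> R) : Prop :=
  exists2 e : R, 0 < e & forall (N : nat) (S : nat -> bool), exists x : X,
    forall i, (i < N)%N -> if S i then e < v x i else v x i < e / 2.

Section dichotomy.
Context {R : realType} {X : Type} (v : X -> nat -> R).
Context {U : set_system nat} {UU : UltraFilter U}.

Definition small (e : R) (D : set X) :=
  U [set n | forall x, D x -> v x n <= e].

Definition sigma_small (e : R) (D : set X) :=
  exists2 F : nat -> set X, (forall i, small e (F i)) & D `<=` \bigcup_i F i.

Lemma sigma_smallS e (D D' : set X) :
  D `<=` D' -> sigma_small e D' -> sigma_small e D.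
Proof. by move=> DD' [F sF D'F]; exists F => //; exact: subset_trans D'F. Qed.

Lemma sigma_small_bigcup (T : countType) e (Q : set T) (F : T -> set X) :
  (forall t, Q t -> sigma_small e (F t)) ->
  sigma_small e (\bigcup_(t in Q) F t).
Proof.
move=> sF.
have /choice[G GF] : forall t, exists G : nat -> set X,
    (forall i, small e (G i)) /\ (Q t -> F t `<=` \bigcup_i G i).
  move=> t; have [/sF[G sG FG]|nQ] := pselect (Q t); first by exists G.
  by exists (fun=> set0); split => // i; apply: (@filterS _ U _ setT) filterT => n _ x [].

exists (fun n => if unpickle n is Some (t, i) then G t i else set0).
  move=> n; case: unpickle => [[t i]|]; first exact: (GF t).1.
  by apply: (@filterS _ U _ setT) filterT => k _ x [].
move=> x [t Qt] /((GF t).2 Qt)[i _ Gx].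
by exists (pickle (t, i)) => //; rewrite pickleK.
Qed.

(** Encoding by lists keeps the patterns countable in number, so that all the sigma-small ones can
    be removed at once. *)
Definition pattern (e : R) (l : seq (nat * bool)) : set X :=
  [set x | forall p, p \in l -> if p.2 then e < v x p.1 else v x p.1 < e / 2].

Lemma pattern_cons e p l x : pattern e (p :: l) x <->
  (if p.2 then e < v x p.1 else v x p.1 < e / 2) /\ pattern e l x.
Proof.
split=> [H|[Hp Hl] q].
  by split=> [|q ql]; apply: H; rewrite inE ?eqxx// ql orbT.
by rewrite inE => /predU1P[->//|]; exact: Hl.
Qed.

(** [m i] is taken in the finitely many sets [M j k] of [U] with [j, k <= i]. A given [x] lies in
    some [F j k] with [j.+1%:R^-1 <= e], so the bound holds from [maxn j k] on. *)
Lemma sigma_small_diagonal (W : nat -> set nat) : (forall i, U (W i)) ->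
  (forall j : nat, sigma_small j.+1%:R^-1 setT) ->
  exists2 m : nat -> nat, (forall i, W i (m i)) &
    forall x e, 0 < e -> \forall i \near \oo, v x (m i) <= e.
Proof.
move=> UW /(_ _)/cid2-/all_sig2[F sF XF].
pose M j k := [set n | forall x, F j k x -> v x n <= j.+1%:R^-1].
have /choice[m mP] : forall i : nat, exists n, W i n /\
    (forall (j k : 'I_i.+1), M j k n).
  move=> i; suff: U (W i `&` [set n | forall (j k : 'I_i.+1), M j k n]).
    by move/filter_ex => -[n [? ?]]; exists n.
  apply: filterI (UW i) _; apply: filter_forall => j; apply: filter_forall => k.
  exact: sF.
exists m => [i|x e e0]; first by have [] := mP i.
have [j je] := exists_invS_le e0.
have [k _ Fx] := XF j x I.
exists (maxn j k) => // i; rewrite /= geq_max => /andP[ji ki].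
apply: le_trans je; have [_] := mP i.
by move=> /(_ (Ordinal (ji : j < i.+1)%N) (Ordinal (ki : k < i.+1)%N)); exact.
Qed.

(* [P] is what remains after removing all the sigma-small patterns: every
   pattern that meets [P] does so in a set that is not sigma-small. *)
Lemma kernel_not_small e : ~ sigma_small e setT ->
  exists P : set X, [/\ P !=set0 & forall l, pattern e l `&` P !=set0 ->
    U [set n | exists2 x, pattern e l x /\ P x & e < v x n]].
Proof.
move=> nsT; pose G := \bigcup_(l in [set l | sigma_small e (pattern e l)]) pattern e l.
have sG : sigma_small e G by exact: sigma_small_bigcup.
exists (~` G); split=> [|l [x [lx Gx]]].
  apply/set0P/eqP => G0; apply: nsT; rewrite -(setCK G) G0 setC0 in sG.
  exact: sG.
have [|nU] := in_ultra_setVsetC [set n | exists2 x, pattern e l x /\ (~` G) x & e < v x n] UU => //.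
exfalso; apply: Gx; exists l => //=.
(* Were the remainder of the pattern small, the pattern would be covered by it and [G], hence
   sigma-small and already removed. *)
have : sigma_small e (\bigcup_(b : bool) if b then G else pattern e l `&` ~` G).
  apply: sigma_small_bigcup => -[] _ //.
  exists (fun=> pattern e l `&` ~` G) => [_|y yG]; last by exists 0%N.
  apply: filterS nU => n /= nU y [ly Gy].
  by rewrite leNgt; apply/negP => evy; apply: nU; exists y.
apply: sigma_smallS => y ly; have [Gy|nGy] := pselect (G y).
  by exists true.
by exists false.
Qed.

(** If [setT] is sigma-small at every threshold, the diagonal sequence gives the first alternative.
    At a threshold [e] where this fails, the kernel [P] supplies values above [e] and the hypothesis
    on [v] values below [e / 2], each for U-many indices. *)
Lemma dichotomy (W : nat -> set nat) :
  (forall x e, 0 < e -> U [set n | v x n < e]) ->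
  (forall i, U (W i)) ->
  (exists2 m : nat -> nat, (forall i, W i (m i)) &
    forall x e, 0 < e -> \forall i \near \oo, v x (m i) <= e) \/
  (exists m : nat -> nat, independent (fun x i => v x (m i))).
Proof.
move=> v0 UW; have [/(sigma_small_diagonal UW)|] :=
  pselect (forall j : nat, sigma_small j.+1%:R^-1 setT); first by left.
move=> /existsNP[j]; set e : R := _^-1; move=> /kernel_not_small[P [P0 PU]].
have e0 : 0 < e by rewrite invr_gt0.
right.
pose good (s : seq nat) := forall b, size b = size s ->
  pattern e (zip s b) `&` P !=set0.
have /choice[st stP] : forall s, exists n, good s -> good (n :: s).
  move=> s; have [gs|] := pselect (good s); last by exists 0%N.
  pose V (b : (size s).-tuple bool) := [set n |
    (exists2 x, pattern e (zip s b) x /\ P x & e < v x n) /\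
    (exists2 x, pattern e (zip s b) x /\ P x & v x n < e / 2)].
  (* There are finitely many sign tuples [b] on [s], so a single [n] extends all of them both
     ways. *)
  have : U [set n | forall b, V b n].
    apply: filter_forall => b.
    have [x [bx Px]] := gs b (size_tuple b).
    apply: filterI; first by apply: PU; exists x.
    by apply: filterS (v0 x (e / 2) (divr_gt0 e0 _)) => // n /= ?; exists x.
  move=> /filter_ex[n nV]; exists n => _ [//|c b] [sb].
  have /= [[x [bx Px] ex] [y [by_ Py] ey]] := nV (tcast sb (in_tuple b)).
  rewrite val_tcast/= in bx by_.
  case: c; [exists x|exists y]; split=> //; exact/pattern_cons.
pose state k := iter k (fun s => st s :: s) [::].
have gstate k : good (state k).
  by elim: k => [|k IH]; [case=> // _; case: P0 => x Px; exists x|exact: stP].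
exists (fun i => st (state i)), e => // N S.
(* [state N] lists the latest index first, so [bs N] lists the values of [S] in the same reversed
   order. *)
pose bs := fix bs k := if k is k'.+1 then S k' :: bs k' else [::].
have sz k : size (bs k) = size (state k) by elim: k => //= k ->.
have [x [Nx _]] := gstate N (bs N) (sz N); exists x => i iN.
suff : (st (state i), S i) \in zip (state N) (bs N) by move/Nx.
elim: N iN {Nx} => // k IH; rewrite ltnS leq_eqVlt inE.
by move=> /predU1P[->|/IH->]; rewrite ?eqxx ?orbT.
Qed.

End dichotomy.

(** * Ultrafilter limits of functionals *)

Lemma ultra_fmap {T V : Type} (f : T -> V) (U : set_system T) :
  UltraFilter U -> UltraFilter (f @ U).
Proof.
move=> UU; split=> [|G GG UG]; first exact: fmap_proper_filter.
apply/seteqP; split => [A GA|]; last exact: UG.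
have [//|UnA] := in_ultra_setVsetC (f @^-1` A) UU.
have GAA : G (A `&` ~` A) by apply: filterI => //; exact: (UG (~` A) UnA).
by have [x [Ax /(_ Ax)]] := filter_ex GAA.
Qed.

Lemma ultra_cvg_bounded {R : realType} {I : Type} (U : set_system I) (u : I -> R) (c : R) :
  UltraFilter U -> (forall i, `|u i| <= c) -> cvg (u @ U).
Proof.
move=> UU uc; have := @segment_compact R (- c) c; rewrite compact_ultra.
move=> /(_ (u @ U) (ultra_fmap u UU))[|l [_ ul]]; last by apply/cvg_ex; exists l.
by apply: (@filterE _ U) => i; rewrite /= in_itv/= -ler_norml.
Qed.

Section dual_space.
Context {R : realType} {E : normedModType R}.
Implicit Types (f : dual E) (x y : E).

Definition dual_bounded (M : R) f := forall x, `|sval f x| <= M * `|x|.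

Lemma dualD f x y : sval f (x + y) = sval f x + sval f y.
Proof. exact: linearD. Qed.

Lemma dualB f x y : sval f (x - y) = sval f x - sval f y.
Proof. exact: linearB. Qed.

Lemma dualN f x : sval f (- x) = - sval f x.
Proof. exact: linearN. Qed.

Lemma dualZ f (a : R) x : sval f (a *: x) = a * sval f x.
Proof. exact: linearZ. Qed.

Lemma dual0 f : sval f 0 = 0.
Proof. exact: linear0. Qed.

Lemma dual_of_linear (F : E -> R) M :
  (forall a x y, F (a *: x + y) = a * F x + F y) ->
  (forall x, `|F x| <= M * `|x|) ->
  exists2 f, dual_bounded M f & forall x, sval f x = F x.
Proof.
move=> linF FM.
pose L := GRing.isLinear.Build R E R^o *:%R F linF.
pose FL : {linear E -> R^o} := HB.pack F L.
have cF : continuous FL.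
  apply/linear_bounded_continuous/linear_boundedP.
  exists M; split; first exact: num_real.
  move=> r Mr x; apply: le_trans (FM x) _.
  by rewrite ler_wpM2r// ltW.
by exists (exist _ FL cF).
Qed.

Lemma zero_dual : exists2 z : dual E, dual_bounded 1 z & forall x, sval z x = 0.
Proof.
apply: (@dual_of_linear (fun=> 0)) => [a x y|x]; first by rewrite mulr0 addr0.
by rewrite normr0 mul1r.
Qed.

Lemma dual_bound f : exists2 M, 0 < M & dual_bounded M f.
Proof.
have /linear_bounded_continuous/linear_boundedP/pinfty_ex_gt0[M M0 fM] := svalP f.
by exists M.
Qed.

Lemma dual_scale f (a : R) : exists g : dual E, forall x, sval g x = a * sval f x.
Proof.
have [M M0 fM] := dual_bound f.
have [||g _ gE] := @dual_of_linear (fun x => a * (sval f x : R)) (`|a| * M).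
- by move=> b x y; rewrite dualD dualZ mulrDr mulrCA.
- by move=> x; rewrite normrM -mulrA ler_wpM2l.
by exists g.
Qed.

(** Banach-Alaoglu in ultrafilter form: the values at each [x] stay in a compact interval, and
    linearity and the bound pass to the limit. *)
Lemma dual_ulim {I : Type} (U : set_system I) (f : I -> dual E) M :
  UltraFilter U -> (forall i, dual_bounded M (f i)) ->
  exists2 g : dual E, dual_bounded M g & forall x, sval (f i) x @[i --> U] --> sval g x.
Proof.
move=> UU fM.
have cf x : cvg (sval (f i) x @[i --> U]).
  by apply: ultra_cvg_bounded UU _ => i; exact: fM.
have [||g gM gE] := @dual_of_linear (fun x => lim (sval (f i) x @[i --> U])) M.
- move=> a x y; apply/cvg_lim => //.
  under eq_cvg do rewrite dualD dualZ.
  by apply: cvgD; [apply: cvgMr|]; exact: cf.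
- move=> x; apply: (cvgr_to_le (cvg_norm (cf x))).
  by apply: nearW => i; exact: fM.
by exists g => // x; rewrite gE; exact: cf.
Qed.

End dual_space.

(** * Weak closures and weakly convergent sequences *)

Section weak_sequences.
Context {R : realType} {E : normedModType R}.
Implicit Types (f : dual E) (x y : E) (A : set E).

Definition unit_dual : Type := {f : dual E | dual_bounded 1 f}.

(** Membership in the weak closure, tested on basic neighbourhoods. The functionals form a sequence
    of which the first [k] count, so that limits can be taken index by index. *)
Definition weakly_adherent A x := forall k (f : nat -> dual E) (e : R), 0 < e ->
  exists2 a, A a & forall i, (i < k)%N -> `|sval (f i) (a - x)| < e.

Definition weak_lim (b : nat -> E) x :=
  forall f, sval f (b n) @[n --> \oo] --> sval f x.

Definition shifted_eval (b : nat -> E) x (f : unit_dual) (n : nat) : R :=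
  sval (sval f) (b n - x).

Lemma dual_normalize f : exists M : R, 0 < M /\ exists g : dual E,
  dual_bounded 1 g /\ forall x, sval f x = M * sval g x.
Proof.
have [M M0 fM] := dual_bound f.
have [g gE] := dual_scale f M^-1.
exists M; split=> //; exists g; split=> x; last by rewrite gE mulrA divff ?mul1r ?gt_eqF.
rewrite gE normrM gtr0_norm ?invr_gt0// mul1r mulrC ler_pdivrMr// mulrC.
exact: fM.
Qed.

Lemma weakly_adherent_unit A x :
  (forall k (f : nat -> dual E) e, 0 < e -> (forall i, dual_bounded 1 (f i)) ->
    exists2 a, A a & forall i, (i < k)%N -> `|sval (f i) (a - x)| < e) ->
  weakly_adherent A x.
Proof.
move=> Ax k f e e0.
have /choice[M /all_and2[M0 /choice[g /all_and2[g1 fg]]]] :=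
  fun i => dual_normalize (f i).
have S0 : 0 <= \sum_(i < k) M i by apply: sumr_ge0 => i _; exact: ltW.
(* The sum dominates each [M i], and the added 1 keeps the denominator positive when [k = 0]. *)
pose e' := e / (1 + \sum_(i < k) M i).
have e'0 : 0 < e' by rewrite divr_gt0// ltr_wpDr.
have [a Aa ax] := Ax k g e' e'0 g1; exists a => // i ik.
rewrite fg normrM gtr0_norm//.
apply: (@lt_le_trans _ _ (M i * e')); first by rewrite ltr_pM2l// ax.
rewrite /e' mulrA ler_pdivrMr ?ltr_wpDr// mulrC ler_pM2l//.
rewrite (bigD1 (Ordinal ik))//= addrCA lerDl addr_ge0//.
by apply: sumr_ge0 => j _; exact: ltW.
Qed.

(** By compactness of the dual ball: if every finite [s] in [A] had a bad tuple [f s], let [g] be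
    the limit of these tuples along an ultrafilter of growing finite sets. A point [a] good for [g]
    is then good for [f s], for some [s] containing [a]. *)
Lemma weakly_adherent_finite A x k e : 0 < e -> weakly_adherent A x ->
  exists2 s : seq E, (forall a, a \in s -> A a) &
    forall f : nat -> dual E, (forall i, dual_bounded 1 (f i)) ->
      exists2 a, a \in s & forall i, (i < k)%N -> `|sval (f i) (a - x)| < e.
Proof.
move=> e0 Ax; apply: contrapT => nA.
have [z z1 _] := @zero_dual R E.
have /choice[f /all_and2[f1 fs]] : forall s : seq E, exists f : nat -> dual E,
    (forall i, dual_bounded 1 (f i)) /\ ((forall a, a \in s -> A a) ->
      forall a, a \in s -> exists2 i, (i < k)%N & e <= `|sval (f i) (a - x)|).
  move=> s; have [sA|] := pselect (forall a, a \in s -> A a); last first.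
    by exists (fun=> z).
  apply: contrapT => nf; apply: nA; exists s => // f f1.
  apply: contrapT => na; apply: nf; exists f; split => // _ a sa.
  apply: contrapT => ni; apply: na; exists a => // i ik.
  by rewrite ltNge; apply/negP => ei; apply: ni; exists i.
pose F := filter_from [set s : seq E | forall a, a \in s -> A a]
  (fun s => [set t : seq E | (forall a, a \in s -> a \in t) /\
                             (forall a, a \in t -> A a)]).
have FF : ProperFilter F.
  apply: filter_from_proper => [|s sA]; last by exists s.
  apply: filter_from_filter; first by exists [::].
  move=> s t sA tA; exists (s ++ t).
    by move=> a /=; rewrite mem_cat => /orP[/sA|/tA].
  by move=> u /= [stu uA]; split; split => // a ?; apply: stu; rewrite mem_cat;
    apply/orP; [left|right].
have [G [GU FG]] := ultraFilterLemma FF.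
have /choice[g gf] : forall i, exists g : dual E,
    forall y, sval (f s i) y @[s --> G] --> sval g y.
  by move=> i; have [g _ ?] := @dual_ulim R E _ G (f^~ i) 1 GU (f1^~ i); exists g.
have [a Aa ax] := Ax k g e e0.
have /filter_ex[s [[sa sA] sx]] : G
    ([set s | (forall b, b \in [:: a] -> b \in s) /\ (forall b, b \in s -> A b)] `&`
     [set s | forall i : 'I_k, `|sval (f s i) (a - x)| < e]).
  apply: filterI; first by apply: FG; exists [:: a] => //= b; rewrite inE => /eqP->.
  apply: filter_forall => i.
  exact: cvgr_norm_lt (gf i (a - x)) _ (ax i (ltn_ord i)).
have [i ik] := fs s sA a (sa _ (mem_head _ _)).
by rewrite leNgt (sx (Ordinal ik)).
Qed.

(** Kaplansky's countable tightness of the weak topology: [b] enumerates the union over [k] of the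
    finite sets that serve [k] functionals of the dual ball with accuracy [k.+1%:R^-1]. *)
Lemma weakly_adherent_countable A x : weakly_adherent A x ->
  exists2 b : nat -> E, (forall n, A (b n)) & weakly_adherent (range b) x.
Proof.
move=> Ax.
have /choice[s /all_and2[sA sx]] : forall k : nat, exists s : seq E,
    (forall a, a \in s -> A a) /\
    forall f : nat -> dual E, (forall i, dual_bounded 1 (f i)) ->
      exists2 a, a \in s & forall i, (i < k)%N -> `|sval (f i) (a - x)| < k.+1%:R^-1.
  move=> k; have [|s ? ?] := @weakly_adherent_finite A x k k.+1%:R^-1 _ Ax.
    by rewrite invr_gt0.
  by exists s.
have [z z1 _] := @zero_dual R E.
have [a0 Aa0 _] := Ax 0%N (fun=> z) 1 ltr01.
pose b n := if unpickle n is Some (k, j) then nth a0 (s k) j else a0.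
exists b => [n|].
  rewrite /b; case: unpickle => [[k j]|//].
  have [jk|kj] := ltnP j (size (s k)); first by apply: (sA k); exact: mem_nth.
  by rewrite nth_default.
apply: weakly_adherent_unit => k f e e0 f1.
have [N Ne] := exists_invS_le e0.
(* Stage [K] serves at least [k] functionals, with accuracy at least as fine as [e]. *)
pose K := maxn k N.
have [a sa ax] := sx K f f1; exists a.
  by exists (pickle (K, index a (s K))) => //; rewrite /b pickleK nth_index.
move=> i ik; apply: lt_le_trans (ax i (leq_trans ik (leq_maxl _ _))) _.
apply: le_trans Ne; rewrite lef_pV2 ?posrE//.
by rewrite ler_nat ltnS leq_maxr.
Qed.

Lemma weakly_adherent_ultra (b : nat -> E) x : weakly_adherent (range b) x ->
  exists2 U : set_system nat, UltraFilter U &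
    forall f, sval f (b n) @[n --> U] --> sval f x.
Proof.
move=> bx.
pose F := filter_from [set ke : nat * (nat -> dual E) * R | 0 < ke.2]
  (fun ke => [set n | forall i, (i < ke.1.1)%N -> `|sval (ke.1.2 i) (b n - x)| < ke.2]).
have FF : ProperFilter F.
  apply: filter_from_proper => [|[[k f] e] /= e0]; last first.
    by have [_ [n _ <-] nx] := bx k f e e0; exists n.
  have [z z1 _] := @zero_dual R E.
  apply: filter_from_filter; first by exists (0%N, fun=> z, 1) => /=.
  move=> [[k f] e] [[l g] d] /= e0 d0.
  (* The two families of functionals are concatenated and the smaller radius is kept. *)
  exists ((k + l)%N, fun i => if (i < k)%N then f i else g (i - k)%N,
    Num.min e d); rewrite /= ?lt_min ?e0//.
  move=> n /= H; split => i il.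
    by have := H i (ltn_addr _ il); rewrite il lt_min => /andP[].
  have := H (k + i)%N; rewrite ltn_add2l => /(_ il).
  by rewrite ltnNge leq_addr/= addKn lt_min => /andP[].
have [U [UU FU]] := ultraFilterLemma FF; exists U => // f.
apply/cvgrPdist_lt => e e0; apply: FU; exists (1%N, fun=> f, e) => //= n.
by move=> /(_ 0%N isT); rewrite dualB distrC.
Qed.

(** The sets [W i] allow the subsequence to be pushed beyond any initial segment. *)
Lemma ultra_weak_dichotomy (b : nat -> E) x (U : set_system nat)
    (W : nat -> set nat) : UltraFilter U ->
  (forall f, sval f (b n) @[n --> U] --> sval f x) ->
  (forall i, U (W i)) ->
  (exists2 m : nat -> nat, (forall i, W i (m i)) & weak_lim (b \o m) x) \/
  (exists m : nat -> nat, independent (shifted_eval (b \o m) x)).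
Proof.
move=> UU bx UW.
have [||[m Wm mx]|?] := @dichotomy R unit_dual (shifted_eval b x) U UU W.
- move=> [f f1] e e0; have /cvgrPdist_lt/(_ _ e0) := bx f.
  apply: filterS => n /=; rewrite distrC /shifted_eval /= dualB.
  exact/le_lt_trans/ler_norm.
- exact: UW.
- left; exists m => // f.
  have [M [M0 [g [g1 fg]]]] := dual_normalize f.
  under eq_cvg do rewrite fg.
  rewrite fg; apply: cvgMr.
  (* The dichotomy bounds from one side only; using it for [g] and for [h = - g] bounds the absolute
     value. *)
  have [h gh] := dual_scale g (-1).
  have h1 : dual_bounded 1 h.
    by move=> y; rewrite gh mulN1r normrN; exact: g1.
  apply/cvgrPdist_le => e e0.
  apply: filterS2 (mx (exist _ g g1) e e0) (mx (exist _ h h1) e e0) => i.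
  rewrite /shifted_eval /= gh dualB mulN1r opprB => gi hi.
  by rewrite ler_norml hi andbT lerNl opprB.
- by right.
Qed.

Lemma weak_dichotomy A x : weakly_adherent A x ->
  (exists2 b : nat -> E, (forall n, A (b n)) & weak_lim b x) \/
  (exists2 b : nat -> E, (forall n, A (b n)) & independent (shifted_eval b x)).
Proof.
move=> /weakly_adherent_countable[b Ab /weakly_adherent_ultra[U UU bx]].
have [|[m _ mx]|[m mx]] := @ultra_weak_dichotomy b x U (fun=> setT) UU bx.
- by move=> _; exact: filterT.
- by left; exists (b \o m) => // n; exact: Ab.
- by right; exists (b \o m) => // n; exact: Ab.
Qed.

(** Functionals realising [S] on the first [N] terms have a weak* limit in the dual ball as [N]
    grows; strict inequalities become weak ones. *)
Lemma independent_infinite_pattern (b : nat -> E) x :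
  independent (shifted_eval b x) -> exists2 e : R, 0 < e &
    forall S : nat -> bool, exists2 f : dual E, dual_bounded 1 f &
      forall i, if S i then e <= sval f (b i - x) else sval f (b i - x) <= e / 2.
Proof.
move=> [e e0 bS]; exists e => // S.
have /choice[f fS] := fun N => bS N S.
have [U [UU ooU]] := ultraFilterLemma eventually_filter.
have [g g1 fg] := @dual_ulim R E _ U (fun N => sval (f N)) 1 UU (fun N => svalP (f N)).
exists g => // i; have : U [set N | (i < N)%N] by apply: ooU; exists i.+1.
case: ifP => Si Ui; [apply: (cvgr_to_ge (fg _))|apply: (cvgr_to_le (fg _))];
  by apply: filterS Ui => N /fS; rewrite Si => /ltW.
Qed.

(* Double limit: [f n] is large on the first [n] terms and small on the later
   ones, so the two iterated limits of [f n (b i - x)] differ, whereas a weak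
   cluster point [z] of [b] in [C] makes both equal to [g (z - x)]. *)
Lemma independent_not_compact (C : set E) (b : nat -> E) x :
  compact (C : set (weak_space E)) -> (forall n, C (b n)) ->
  ~ independent (shifted_eval b x).
Proof.
move=> Cc Cb /independent_infinite_pattern[e e0 bS].
have [U [UU ooU]] := ultraFilterLemma eventually_filter.
move: Cc; rewrite compact_ultra.
move=> /(_ _ (@ultra_fmap _ (weak_space E) b U UU))[|z [_ bz]].
  by apply: (@filterE _ U) => n; exact: Cb.
have {}bz (f : dual E) : sval f (b n - x) @[n --> U] --> sval f (z - x).
  under eq_cvg do rewrite dualB.
  by rewrite dualB; apply: cvgB; [move/cvg_weakP : bz; exact|exact: cvg_cst].
have /choice[f /all_and2[f1 fn]] : forall n, exists f : dual E, dual_bounded 1 f /\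
    forall i, if (i < n)%N then e <= sval f (b i - x) else sval f (b i - x) <= e / 2.
  by move=> n; have [f ? ?] := bS (fun i => (i < n)%N); exists f.
have [g g1 fg] := @dual_ulim R E _ U f 1 UU f1.
have ge : e <= sval g (z - x).
  apply: (cvgr_to_ge (bz g)); apply: nearW => i.
  apply: (cvgr_to_ge (fg _)); apply: ooU; exists i.+1 => // n /= ni.
  by have := fn n i; rewrite ni.
have : sval g (z - x) <= e / 2.
  apply: (cvgr_to_le (fg _)); apply: nearW => n.
  apply: (cvgr_to_le (bz _)); apply: ooU; exists n => // i /= ni.
  by have := fn n i; rewrite ltnNge ni.
by move/(le_trans ge); rewrite leNgt ltr_pdivrMr// ltr_pMr// ltr1n.
Qed.

End weak_sequences.

(** * Copies of l1 *)

Section ell1_embedding.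
Context {R : realType} {E : completeNormedModType R}.
Variables (d : nat -> E) (c : R) (dc : forall n, `|d n| <= c).

Let term (y : ell1 R) (n : nat) : E := y n *: d n.

Let c_ge0 : 0 <= c. Proof. exact: le_trans (dc 0). Qed.

Let term_le (y : ell1 R) n : `|term y n| <= c * `|y n|.
Proof. by rewrite normrZ mulrC ler_wpM2r. Qed.

Let term_cvg (y : ell1 R) : cvgn (series (term y)).
Proof.
apply: normed_cvg; apply: (@series_le_cvg R _ (c *: [sequence `|y n|]_n)).
- by move=> n; exact: normr_ge0.
- by move=> n; exact: mulr_ge0 c_ge0 (normr_ge0 _).
- by move=> n; exact: term_le.
- by apply: is_cvg_seriesZ; exact: ell1_cvg.
Qed.

Definition ell1_series (y : ell1 R) : E := limn (series (term y)).

Lemma ell1_series_linear (a : R) (y z : ell1 R) :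
  ell1_series (a *: y + z) = a *: ell1_series y + ell1_series z.
Proof.
have ty := @term_cvg y; have tz := @term_cvg z.
apply/cvg_lim => //.
rewrite (_ : series _ = (fun n => a *: series (term y) n + series (term z) n)).
  by apply: cvgD => //; apply: cvgZl_tmp.
apply/funext => n; rewrite /series /= scaler_sumr -big_split/=.
by apply: eq_bigr => i _; rewrite /term /= scalerDl scalerA.
Qed.

Lemma ell1_series_bounded (y : ell1 R) : `|ell1_series y| <= c * `|y|.
Proof.
apply: (cvgr_to_le (cvg_norm (@term_cvg y))); apply: nearW => n.
apply: (@le_trans _ _ (c * [normed series y] n)).
  rewrite /series/= (le_trans (ler_norm_sum _ _ _))// mulr_sumr.
  by apply: ler_sum => i _; exact: term_le.
rewrite ler_wpM2l//; apply: nondecreasing_cvgn_le (ell1_cvg y) n.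
by apply: nondecreasing_series => i _ _; exact: normr_ge0.
Qed.

Lemma dual_ell1_series (f : dual E) (y : ell1 R) :
  series (fun n => y n * sval f (d n)) @ \oo --> sval f (ell1_series y).
Proof.
rewrite (_ : series _ = (fun n => sval f (series (term y) n))).
  by apply: continuous_cvg (@term_cvg y); exact: (svalP f).
apply/funext => n; rewrite /series /= linear_sum.
by apply: eq_bigr => i _; rewrite linearZ.
Qed.

(** The thresholds [e] and [e / 2] have the same sign, so two functionals with opposite patterns are
    subtracted: each term of [f - g] is at least [e / 2 * |y i|]. As [f - g] has norm at most 2, the
    constant [e / 4] results. *)
Lemma ell1_series_lower (e : R) (y : ell1 R) :
  (forall S : nat -> bool, exists2 f : dual E, dual_bounded 1 f &
    forall i, if S i then e <= sval f (d i) else sval f (d i) <= e / 2) ->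
  e / 4 * `|y| <= `|ell1_series y|.
Proof.
move=> dS.
have [f f1 fS] := dS (fun i => 0 < y i).
have [g g1 gS] := dS (fun i => ~~ (0 < y i)).
have : e / 2 * `|y| <= sval f (ell1_series y) - sval g (ell1_series y).
  have fg := cvgB (FF := eventually_filter) (@dual_ell1_series f y) (@dual_ell1_series g y).
  have ye := @cvgMl_tmp _ _ _ eventually_filter _ (e / 2) _ (ell1_cvg y).
  apply: ler_cvg_to ye fg _; apply: nearW => n.
  rewrite /series/= fctE /= mulr_sumr -sumrB; apply: ler_sum => i _.
  rewrite -mulrBr; have := fS i; have := gS i.
  case: ltP => /= yi gi fi.
    by rewrite gtr0_norm// mulrC; apply: ler_wpM2l; [exact: ltW|lra].
  by rewrite ler0_norm// mulrN -mulNr mulrC; apply: ler_wnM2l => //; lra.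
have := ler_norm (sval f (ell1_series y)); have := ler_norm (- sval g (ell1_series y)).
have := f1 (ell1_series y); have := g1 (ell1_series y); rewrite normrN !mul1r.
by rewrite -(ler_pM2l (_ : 0 < 2 :> R))//; lra.
Qed.

Lemma contains_ell1 (e : R) : 0 < e ->
  (forall S : nat -> bool, exists2 f : dual E, dual_bounded 1 f &
    forall i, if S i then e <= sval f (d i) else sval f (d i) <= e / 2) ->
  contains_isomorphic_copy (ell1 R) E.
Proof.
move=> e0 dS.
pose L := GRing.isLinear.Build R (ell1 R) E *:%R ell1_series ell1_series_linear.
pose T : {linear ell1 R -> E} := HB.pack ell1_series L.
have low y : e / 4 * `|y| <= `|T y| by exact: ell1_series_lower.
have e40 : 0 < e / 4 by rewrite divr_gt0.
have /choice[S ST] : forall z : E, exists y, range T z -> T y = z.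
  move=> z; have [[y _ yz]|nz] := pselect (range T z); first by exists y.
  by exists 0.
have Tinj : injective T.
  move=> y z yz; apply/eqP; rewrite -subr_eq0 -normr_le0.
  rewrite -(ler_pM2l e40) mulr0 (le_trans (low _))//.
  by rewrite linearB yz subrr normr0.
exists T, S; split.
- apply/linear_bounded_continuous/linear_boundedP; exists c; split.
    exact: num_real.
  move=> r cr y; rewrite (le_trans (ell1_series_bounded y))//.
  by rewrite ler_wpM2r// ltW.
- by move=> y; apply: Tinj; rewrite ST.
- apply/subspace_continuousP => _ [y _ <-].
  apply/cvgrPdist_lt => r r0; near=> z.
  have rz : range T z by near: z; exact: withinT.
  rewrite -(ltr_pM2l e40) (le_lt_trans (low _))// linearB !ST//.
  near: z; apply: cvg_within; apply: (@cvgr_dist_lt _ _ _ _ _ id) => //.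
  by rewrite mulr_gt0.
Unshelve. all: by end_near. Qed.

End ell1_embedding.

Lemma independent_contains_ell1 {R : realType} {E : completeNormedModType R}
    (b : nat -> E) (x : E) (c : R) : (forall n, `|b n - x| <= c) ->
  independent (shifted_eval b x) -> contains_isomorphic_copy (ell1 R) E.
Proof.
move=> bc /independent_infinite_pattern[e e0 bS].
exact: (@contains_ell1 R E (fun n => b n - x) c bc e e0 bS).
Qed.

(** * The Hahn-Banach theorem *)

Section hahn_banach.
Context {R : realType} {E : normedModType R}.
Implicit Types (G : set (E * R)) (M : R).

(** Partial functionals are represented by their graphs, which Zorn's lemma orders by inclusion;
    that a graph is single-valued will follow from domination. *)
Definition linear_graph G := forall (a : R) p q, G p -> G q ->
  G (a *: p.1 + q.1, a * p.2 + q.2).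

Definition dominated_graph M G := forall p, G p -> p.2 <= M * `|p.1|.

Definition graph_extension G (x0 : E) (c : R) : set (E * R) :=
  [set p | exists t, exists2 q, G q & p = (q.1 + t *: x0, q.2 + t * c)].

Lemma linear_graph0 G : G !=set0 -> linear_graph G -> G (0, 0).
Proof.
move=> [p Gp] linG; have := linG (-1) p p Gp Gp.
by rewrite scaleN1r mulN1r !addNr.
Qed.

Lemma linear_graphZ G a p : G !=set0 -> linear_graph G -> G p ->
  G (a *: p.1, a * p.2).
Proof.
move=> G0 linG Gp; have := linG a p _ Gp (linear_graph0 G0 linG).
by rewrite !addr0.
Qed.

(** The difference of the two values lies over 0 in the graph, where domination makes it
    nonpositive; exchanging the values gives equality. *)
Lemma dominated_graph_functional M G x a b : G !=set0 -> linear_graph G ->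
  dominated_graph M G -> G (x, a) -> G (x, b) -> a = b.
Proof.
move=> G0 linG domG.
suff H c d : G (x, c) -> G (x, d) -> c <= d.
  by move=> Ga Gb; apply/eqP; rewrite eq_le !H.
move=> Gc Gd; have := domG _ (linG (-1) _ _ Gd Gc).
by rewrite /= scaleN1r mulN1r addNr normr0 mulr0 addrC subr_le0.
Qed.

Lemma graph_extension_linear G x0 c :
  linear_graph G -> linear_graph (graph_extension G x0 c).
Proof.
move=> linG a _ _ [t [p Gp ->]] [s [q Gq ->]].
exists (a * t + s); exists (a *: p.1 + q.1, a * p.2 + q.2); first exact: linG.
by congr pair => /=; rewrite ?scalerDr ?scalerDl ?mulrDr ?mulrDl ?scalerA ?mulrA addrACA.
Qed.

(** [c] must lie above all [p.2 - M * |p.1 - x0|] and below all [M * |q.1 + x0| - q.2]. The triangle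
    inequality separates the two families, and [c] is the supremum of the first. Dividing by [|t|]
    reduces to the coefficients 1 and -1 of [x0]. *)
Lemma graph_extension_dominated M G x0 : 0 <= M -> G !=set0 ->
  linear_graph G -> dominated_graph M G ->
  exists c, dominated_graph M (graph_extension G x0 c).
Proof.
move=> M0 G0 linG domG.
pose B := [set p.2 - M * `|p.1 - x0| | p in G].
have Bub q : G q -> ubound B (M * `|q.1 + x0| - q.2).
  move=> Gq _ [p Gp <-]; rewrite lerBrDr addrAC lerBlDr -mulrDr.
  have := domG _ (linG 1 _ _ Gp Gq); rewrite /= scale1r mul1r => /le_trans; apply.
  rewrite ler_wpM2l// [leRHS]addrC (le_trans _ (ler_normD _ _))//.
  by rewrite addrACA addNr addr0.
have hsB : has_sup B.
  have [p Gp] := G0; split; first by exists (p.2 - M * `|p.1 - x0|), p.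
  by exists (M * `|p.1 + x0| - p.2); exact: Bub.
exists (sup B) => _ [t [p Gp ->]] /=.
have [t0|t0|->] := ltgtP t 0; last by rewrite scale0r mul0r !addr0; exact: domG.
- have Gq := linear_graphZ (- t^-1) G0 linG Gp.
  have : (- t^-1) * p.2 - M * `|- t^-1 *: p.1 - x0| <= sup B.
    by apply: sup_upper_bound => //; exists (- t^-1 *: p.1, - t^-1 * p.2).
  have -> : - t^-1 *: p.1 - x0 = - t^-1 *: (p.1 + t *: x0).
    by rewrite scalerDr scalerA mulNr mulVf ?lt_eqF// scaleN1r.
  rewrite normrZ gtr0_norm ?oppr_gt0 ?invr_lt0// mulrCA -mulrBr.
  move=> /(ler_wpM2l (_ : 0 <= - t)); rewrite oppr_ge0 (ltW t0) => /(_ isT).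
  by rewrite mulrA mulrNN divff ?lt_eqF// mul1r => H; lra.
- have Gq := linear_graphZ t^-1 G0 linG Gp.
  have : sup B <= M * `|t^-1 *: p.1 + x0| - t^-1 * p.2.
    by apply: ge_sup; [exact: hsB.1|exact: Bub Gq].
  have -> : t^-1 *: p.1 + x0 = t^-1 *: (p.1 + t *: x0).
    by rewrite scalerDr scalerA mulVf ?gt_eqF// scale1r.
  rewrite normrZ gtr0_norm ?invr_gt0// mulrCA -mulrBr.
  move=> /(ler_wpM2l (ltW t0)).
  by rewrite mulrA divff ?gt_eqF// mul1r => H; lra.
Qed.

Lemma hahn_banach_graph M G : 0 <= M -> G !=set0 -> linear_graph G ->
  dominated_graph M G ->
  exists2 f : dual E, dual_bounded M f & forall p, G p -> sval f p.1 = p.2.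
Proof.
move=> M0 G0 linG domG.
(* The condition bears on the union of [G] and [H], so that for the empty chain it reduces to the
   hypotheses on [G]. *)
pose P (H : set (E * R)) := linear_graph (G `|` H) /\ dominated_graph M (G `|` H).
have GU (H : set (E * R)) : G `|` H !=set0 by case: G0 => p Gp; exists p; left.
have [F FP totF|H [[linH domH] maxH]] := @Zorn_bigcup _ P.
  have bigU p : (G `|` \bigcup_(H in F) H) p ->
      G p \/ exists2 H, F H & (G `|` H) p.
    by move=> [|[H FH Hp]]; [left|right; exists H => //; right].
  split=> [a p q|p /bigU[/domG//|[H FH Hp]]]; last exact: (FP H FH).2.
  move=> /bigU Gp /bigU Gq.
  have sub H r : F H -> (G `|` H) r -> (G `|` \bigcup_(H in F) H) r.
    by move=> FH [|Hr]; [left|right; exists H].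
  case: Gp Gq => [Gp|[H FH Hp]] [Gq|[K FK Kq]].
  - by left; exact: linG.
  - by apply: (sub K) => //; apply: (FP K FK).1 => //; left.
  - by apply: (sub H) => //; apply: (FP H FH).1 => //; left.
  - have [HK|KH] := totF H K FH FK.
      by apply: (sub K) => //; apply: (FP K FK).1 => //; case: Hp => [|/HK]; [left|right].
    by apply: (sub H) => //; apply: (FP H FH).1 => //; case: Kq => [|/KH]; [left|right].
have GHE : G `<=` H.
  move=> p Gp; apply: contrapT => nHp; apply: (maxH (G `|` H)).
    by split=> [|/(_ p)]; [exact: subsetUr|move=> /(_ (or_introl Gp))].
  by rewrite /P setUA setUid.
have GH : G `|` H = H by apply/seteqP; split=> [p [/GHE|]//|p]; right.
rewrite GH in linH domH.
have H0 : H !=set0 by rewrite -GH.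
have /choice[h hH] : forall x, exists b, H (x, b).
  move=> x; apply: contrapT => nx.
  have [c domc] := graph_extension_dominated x M0 H0 linH domH.
  have HX : H `<=` graph_extension H x c.
    by move=> [y b] Hp; exists 0, (y, b) => //=; rewrite scale0r mul0r !addr0.
  apply: (maxH (graph_extension H x c)).
    split=> // /(_ (x, c)) XH; apply: nx; exists c; apply: XH.
    exists 1, (0, 0); first exact: linear_graph0.
    by rewrite scale1r mul1r !add0r.
  rewrite /P; have -> : G `|` graph_extension H x c = graph_extension H x c.
    by apply/seteqP; split=> [p [/GHE/HX|]//|p]; right.
  by split=> //; exact: graph_extension_linear.
have hE x b : H (x, b) -> h x = b.
  exact: dominated_graph_functional H0 linH domH (hH x).
have [||f fM fE] := @dual_of_linear R E h M.
- by move=> a x y; apply: hE; exact: linH a (x, h x) (y, h y) (hH x) (hH y).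
- move=> x; rewrite ler_norml lerNl (domH _ (hH x)) andbT.
  have := domH _ (linear_graphZ (-1) H0 linH (hH x)).
  by rewrite /= scaleN1r mulN1r normrN.
by exists f => // -[x b] /GHE/hE <-; rewrite fE.
Qed.

Lemma dual_separating (x : E) : x != 0 -> exists f : dual E, sval f x != 0.
Proof.
move=> x0.
have [|||[y b] [t /= [-> ->]]|f _ /(_ (x, `|x|))] :=
  @hahn_banach_graph 1 [set p | exists t, p.1 = t *: x /\ p.2 = t * `|x|] => //.
- by exists (0, 0), 0; rewrite /= scale0r mul0r.
- move=> a [_ _] [_ _] [t /= [-> ->]] [s /= [-> ->]]; exists (a * t + s).
  by rewrite /= scalerDl mulrDl scalerA mulrA.
- by rewrite mul1r normrZ ler_wpM2r// ler_norm.
move=> /= fx; exists f; rewrite fx ?normr_eq0//.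
by exists 1; rewrite scale1r mul1r.
Qed.

End hahn_banach.

(** * Sign functionals on a copy of l1 *)

Section ell1_copy.
Context {R : realType}.

Definition ell1_unit_fun (n : nat) : nat -> R := fun k => (k == n)%:R.

Lemma sum_ell1_unit {V : lmodType R} (d : nat -> V) n m : (n < m)%N ->
  \sum_(0 <= k < m) ell1_unit_fun n k *: d k = d n.
Proof.
move=> nm; rewrite big_mkord (bigD1 (Ordinal nm))//= {1}/ell1_unit_fun eqxx scale1r.
rewrite big1 ?addr0// => k; rewrite -val_eqE /ell1_unit_fun /= => /negPf ->.
by rewrite scale0r.
Qed.

Lemma cvg_sum_ell1_unit {V : normedModType R} (d : nat -> V) n :
  series (fun k => ell1_unit_fun n k *: d k) @ \oo --> d n.
Proof.
apply: cvg_near_cst; exists n.+1 => // m /= nm.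
by rewrite /series/= sum_ell1_unit.
Qed.

Lemma cvg_normed_ell1_unit n : [normed series (ell1_unit_fun n)] @ \oo --> (1 : R).
Proof.
rewrite (_ : [normed series _] = series (fun k => ell1_unit_fun n k *: (1 : R^o))).
  exact: (@cvg_sum_ell1_unit R^o (fun=> 1) n).
apply/funext => m; apply: eq_bigr => k _ /=.
by rewrite /ell1_unit_fun normr_nat /GRing.scale/= mulr1.
Qed.

Lemma ell1_unit_proof n : ell1_unit_fun n \in @ell1_pred R.
Proof. by apply/ell1P; apply: cvgP (cvg_normed_ell1_unit n). Qed.

Definition ell1_unit n : ell1 R := Ell1 (ell1_unit_proof n).

Lemma norm_ell1_unit n : `|ell1_unit n| = 1.
Proof. by apply/cvg_lim => //; exact: cvg_normed_ell1_unit. Qed.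

Lemma ell1_series_unit {E : completeNormedModType R} (d : nat -> E) n :
  ell1_series d (ell1_unit n) = d n.
Proof. by apply/cvg_lim => //; exact: cvg_sum_ell1_unit. Qed.

Definition sign_of (b : bool) : R := if b then 1 else -1.

Lemma norm_sign_of b : `|sign_of b| = 1.
Proof. by case: b; rewrite /sign_of ?normrN normr1. Qed.

Lemma isomorphic_copy_lower {X E : normedModType R} (T : {linear X -> E}) S :
  cancel T S -> {within range T, continuous S} ->
  exists2 M : R, 0 < M & forall x, `|x| <= M * `|T x|.
Proof.
move=> TK /subspace_continuousP/(_ (T 0))/(_ (imageT T 0)).
rewrite linear0 => /cvgrPdist_lt/(_ 1 ltr01).
rewrite near_withinE => /nbhs_norm0P[r /= r0 Sr].
have S0 : S 0 = 0 by rewrite -(TK 0) linear0.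
exists (2 / r); first by rewrite divr_gt0.
move=> x; have [Tx0|Tx0] := eqVneq (T x) 0.
  by rewrite Tx0 -(TK x) Tx0 S0 !normr0 mulr0.
have nTx : 0 < `|T x| by rewrite normr_gt0.
(* [a] scales [T x] to norm [r / 2], inside the ball where [S] has norm below 1; hence the constant
   [2 / r]. *)
pose a := r / 2 / `|T x|.
have a0 : 0 < a by rewrite !divr_gt0.
have := Sr (T (a *: x)); rewrite /from_subspace /= TK S0 sub0r normrN normrZ gtr0_norm//.
have -> : `|T (a *: x)| < r.
  by rewrite linearZ normrZ gtr0_norm// /a divfK ?gt_eqF// ltr_pdivrMr// ltr_pMr// ltr1n.
move=> /(_ isT (imageT T _))/ltW.
by rewrite -ler_pdivlMl// mulr1 /a !invf_div mulrC.
Qed.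

(** On the range of [T], the sum of the [s n * y n] is at most [|y| <= M * |T y|], and Hahn-Banach
    extends this functional. Dividing the images of the unit vectors by the bound [K] of [T] puts
    them in the unit ball and costs a factor [K] in the bound. *)
Lemma ell1_copy_signs {E : completeNormedModType R} :
  contains_isomorphic_copy (ell1 R) E ->
  exists (e : nat -> E) (M : R), [/\ 0 < M, forall n, `|e n| <= 1 &
    forall s : nat -> bool, exists2 f : dual E, dual_bounded M f &
      forall n, sval f (e n) = sign_of (s n)].
Proof.
move=> [T [S [cT TK cS]]].
have [M M0 TM] := isomorphic_copy_lower TK cS.
have /linear_bounded_continuous/linear_boundedP/pinfty_ex_gt0[K K0 TK'] := cT.
exists (fun n => K^-1 *: T (ell1_unit n)), (K * M); split.
- exact: mulr_gt0.
- move=> n; rewrite normrZ gtr0_norm ?invr_gt0// mulrC ler_pdivrMr// mul1r.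
  by have := TK' (ell1_unit n); rewrite norm_ell1_unit mulr1.
(* With the signs seen as vectors of the real line, [ell1_series d] is the functional on l1 that
   pairs with [s]. *)
move=> s; pose d n : R^o := sign_of (s n).
have d1 n : `|d n| <= 1 by rewrite /d norm_sign_of.
have [||||f fM fT] := @hahn_banach_graph R E M
    [set p | exists y, p = (T y, ell1_series d y)].
- exact: ltW.
- by exists (T 0, ell1_series d 0), 0.
- move=> a _ _ [y ->] [z ->]; exists (a *: y + z); congr pair => /=.
    by rewrite linearP.
  by rewrite (ell1_series_linear d1).
- move=> _ [y ->] /=; rewrite (le_trans (ler_norm _))//.
  by rewrite (le_trans (ell1_series_bounded d1 y))// mul1r.
have [g gE] := dual_scale f K; exists g.
  by move=> x; rewrite gE normrM gtr0_norm// -mulrA ler_wpM2l// ltW.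
move=> n; rewrite gE linearZ /= (fT (_, d n)); last first.
  by exists (ell1_unit n); rewrite ell1_series_unit.
by rewrite /GRing.scale/= mulrA divff ?mul1r ?gt_eqF.
Qed.

End ell1_copy.

Arguments sign_of R b : clear implicits.

(** * Means over sign sequences *)

Section finite_intersections.
Context {R : realType} {T : Type} (mu : set T -> R).
Hypothesis muT : mu setT = 1.
Hypothesis mu0 : mu set0 = 0.
Hypothesis muU : forall B C, mu (B `|` C) + mu (B `&` C) = mu B + mu C.
Hypothesis le_mu : forall B C, B `<=` C -> mu B <= mu C.

Let mu_ge0 B : 0 <= mu B. Proof. by rewrite -mu0; exact: le_mu. Qed.

(* If [B] charges V-many [A j] uniformly but no [B `&` A k] does, then unions of
   sets [B `&` A k] have unbounded measure. *)
Lemma additive_intersections (A : nat -> set T) (d : R) : 0 < d ->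
  (forall k, d <= mu (A k)) ->
  exists2 m : nat -> nat, (forall i, (i <= m i)%N) &
    forall n, exists s, forall i, (i < n)%N -> A (m i) s.
Proof.
move=> d0 dA; have [V [VU ooV]] := ultraFilterLemma eventually_filter.
pose null C := forall h, 0 < h -> V [set j | mu (C `&` A j) < h].
have null0 : null set0.
  by move=> h h0; apply: (@filterS _ V _ setT) filterT => j _ /=; rewrite set0I mu0.
have nullT : ~ null setT.
  move=> /(_ d d0)/filter_ex[j /=]; rewrite setTI => /(le_lt_trans (dA j)).
  by rewrite ltxx.
have step B n : ~ null B -> exists2 k, (n <= k)%N & ~ null (B `&` A k).
  move=> nB; apply: contrapT => nk.
  have BA k : (n <= k)%N -> null (B `&` A k).
    by move=> nk'; apply: contrapT => ?; apply: nk; exists k.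
  have [h h0 Vh] : exists2 h : R, 0 < h & V [set j | h <= mu (B `&` A j)].
    apply: contrapT => nh; apply: nB => h h0.
    have [//|Vn] := in_ultra_setVsetC [set j | mu (B `&` A j) < h] VU.
    exfalso; apply: nh; exists h => //; apply: filterS Vn => j /=.
    by rewrite leNgt => /negP.
  have h20 : 0 < h / 2 by rewrite divr_gt0.
  have grow p : exists2 C, null C & p%:R * (h / 2) <= mu C.
    elim: p => [|p [C nC pC]]; first by exists set0; rewrite // mul0r.
    (* The added intersection has measure at least [h] and meets [C] in less than [h / 2], so each
       union gains at least [h / 2]. *)
    have /filter_ex[k [[/= hk Ck] nk']] : V ([set k | h <= mu (B `&` A k)] `&`
        [set k | mu (C `&` A k) < h / 2] `&` [set k | (n <= k)%N]).
      by apply: filterI; [exact: filterI Vh (nC _ h20)|apply: ooV; exists n].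
    exists (C `|` (B `&` A k)).
      move=> r r0; have r20 : 0 < r / 2 by rewrite divr_gt0.
      apply: filterS2 (nC _ r20) (BA k nk' _ r20) => j /= Cr Br.
      rewrite setIUl; have := muU (C `&` A j) (B `&` A k `&` A j).
      have := mu_ge0 (C `&` A j `&` (B `&` A k `&` A j)); lra.
    have := muU C (B `&` A k); rewrite -natr1 mulrDl mul1r.
    have : mu (C `&` (B `&` A k)) <= mu (C `&` A k) by apply: le_mu => x [? []].
    lra.
  have [C _] := grow (Num.truncn (h / 2)^-1).+1.
  apply/negP; rewrite -ltNge (@le_lt_trans _ _ 1)//; first by rewrite -muT le_mu.
  by rewrite -ltr_pdivrMr// mul1r truncnS_gt.
have /choice[st stP] : forall Bi : set T * nat, exists k, ~ null Bi.1 ->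
    (Bi.2 <= k)%N /\ ~ null (Bi.1 `&` A k).
  move=> [B i] /=; have [nB|] := pselect (null B); first by exists 0%N.
  by move=> /step => /(_ i)[k ? ?]; exists k.
pose Bs := fix Bs i := if i is j.+1 then Bs j `&` A (st (Bs j, j)) else setT.
have nBs i : ~ null (Bs i).
  by elim: i => [|i IH]; [exact: nullT|have [] := stP (Bs i, i) IH].
exists (fun i => st (Bs i, i)) => [i|n]; first by have [] := stP (Bs i, i) (nBs i).
have [s Bsn] : Bs n !=set0.
  by apply/set0P/eqP => B0; have := nBs n; rewrite B0.
exists s => i; elim: n Bsn => //= n IH [/IH{}IH An].
by rewrite ltnS leq_eqVlt => /predU1P[->|].
Qed.

End finite_intersections.

Section mean.
Context {R : realType}.
Implicit Types (F G : (nat -> bool) -> R) (s : nat -> bool).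

Definition scons (b : bool) s : nat -> bool :=
  fun n => if n is n'.+1 then s n' else b.

(** Uniform average over the [2 ^ N] sequences that are free on the first [N] coordinates and
    [false] afterwards. *)
Fixpoint average (N : nat) F : R :=
  if N is N'.+1 then
    (average N' (F \o scons true) + average N' (F \o scons false)) / 2
  else F (fun=> false).

Lemma average_linear N a F G :
  average N (fun s => a * F s + G s) = a * average N F + average N G.
Proof.
elim: N F G => //= N IH F G.
rewrite (IH (F \o scons true) (G \o scons true)).
rewrite (IH (F \o scons false) (G \o scons false)); lra.
Qed.

Lemma average_le N F G : (forall s, F s <= G s) -> average N F <= average N G.
Proof.
elim: N F G => //= N IH F G FG; rewrite ler_pM2r ?invr_gt0// lerD// IH// => s;
  exact: FG.
Qed.

Lemma average_cst N a : average N (fun=> a) = a.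
Proof. by elim: N => //= N; rewrite /comp => ->; lra. Qed.

(** Orthogonality of the Rademacher functions: coordinates are peeled off until the smaller index is
    0, where the two values of the sign cancel. *)
Lemma average_signs N n k : (n < k)%N -> (k < N)%N ->
  average N (fun s => sign_of R (s n) * sign_of R (s k)) = 0.
Proof.
elim: N n k => // N IH [|n] [|k]//= nk kN; last first.
  by rewrite (IH n k nk kN) addr0 mul0r.
rewrite {1}/comp /= {1}/comp /=.
have -> : (fun s => sign_of R true * sign_of R (s k)) =
    (fun s => sign_of R (s k)) by apply/funext => s; rewrite mul1r.
have -> : (fun s => sign_of R false * sign_of R (s k)) =
    (fun s => -1 * sign_of R (s k) + (fun=> 0) s).
  by apply/funext => s; rewrite /sign_of addr0.
by rewrite average_linear average_cst mulN1r addr0 subrr mul0r.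
Qed.

Definition bounded_on_signs F := exists c, forall s, `|F s| <= c.

Lemma bounded_on_signs_cst a : bounded_on_signs (fun=> a).
Proof. by exists `|a|. Qed.

Lemma bounded_on_signsD F G : bounded_on_signs F -> bounded_on_signs G ->
  bounded_on_signs (fun s => F s + G s).
Proof.
move=> [c Fc] [d Gd]; exists (c + d) => s.
by rewrite (le_trans (ler_normD _ _))// lerD.
Qed.

Lemma bounded_on_signsM F G : bounded_on_signs F -> bounded_on_signs G ->
  bounded_on_signs (fun s => F s * G s).
Proof.
move=> [c Fc] [d Gd]; exists (c * d) => s.
by rewrite normrM ler_pM.
Qed.

Lemma bounded_on_signs_norm F : bounded_on_signs F ->
  bounded_on_signs (fun s => `|F s|).
Proof. by move=> [c Fc]; exists c => s; rewrite normr_id. Qed.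

Lemma bounded_on_signs_sign n : bounded_on_signs (fun s => sign_of R (s n)).
Proof. by exists 1 => s; rewrite norm_sign_of. Qed.

Lemma bounded_on_signs_indic (B : set (nat -> bool)) : bounded_on_signs (\1_B).
Proof.
by exists 1 => s; rewrite indicE ger0_norm ?ler0n// lern1 leq_b1.
Qed.

Context {U : set_system nat} {UU : UltraFilter U}.
Hypothesis ooU : \oo `<=` U.

(** A finitely additive substitute for Haar measure on the Cantor group. It applies to every bounded
    function, as integrands built from arbitrarily chosen functionals require. *)
Definition mean F : R := lim (average N F @[N --> U]).

Lemma cvg_mean F : bounded_on_signs F -> average N F @[N --> U] --> mean F.
Proof.
move=> [c Fc]; apply: (@ultra_cvg_bounded R nat U (average ^~ F) c UU) => N.
rewrite ler_norml -{1}(average_cst N (- c)) -{2}(average_cst N c).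
by rewrite !average_le// => s; have := Fc s; rewrite ler_norml => /andP[].
Qed.

Lemma mean_linear a F G : bounded_on_signs F -> bounded_on_signs G ->
  mean (fun s => a * F s + G s) = a * mean F + mean G.
Proof.
move=> bF bG; apply/cvg_lim => //.
under eq_cvg do rewrite average_linear.
by apply: cvgD; [apply: cvgMl_tmp|]; exact: cvg_mean.
Qed.

Lemma mean_le F G : bounded_on_signs F -> bounded_on_signs G ->
  (forall s, F s <= G s) -> mean F <= mean G.
Proof.
move=> bF bG FG; apply: ler_cvg_to (cvg_mean bF) (cvg_mean bG) _.
by apply: nearW => N; exact: average_le.
Qed.

Lemma mean_cst a : mean (fun=> a) = a.
Proof.
apply/cvg_lim => //; under eq_cvg do rewrite average_cst; exact: cvg_cst.
Qed.

Lemma mean_signs n k : n != k ->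
  mean (fun s => sign_of R (s n) * sign_of R (s k)) = 0.
Proof.
wlog nk : n k / (n < k)%N.
  move=> H; rewrite neq_ltn => /orP[nk|kn]; first by rewrite H// neq_ltn nk.
  under [X in mean X]eq_fun do rewrite mulrC.
  by apply: H; rewrite // neq_ltn kn.
move=> _; apply/cvg_lim => //; apply: cvg_near_cst; apply: ooU.
by exists k.+1 => // N /= kN; exact: average_signs.
Qed.

Definition sign_measure (B : set (nat -> bool)) : R := mean (\1_B).

Lemma sign_measure_intersections (A : nat -> set (nat -> bool)) (d : R) :
  0 < d -> (forall k, d <= sign_measure (A k)) ->
  exists2 m : nat -> nat, (forall i, (i <= m i)%N) &
    forall n, exists s, forall i, (i < n)%N -> A (m i) s.
Proof.
have b1 := bounded_on_signs_indic.
apply: additive_intersections.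
- by rewrite /sign_measure indicT mean_cst.
- by rewrite /sign_measure indic0 mean_cst.
- move=> B C; rewrite -[LHS]mul1r -[RHS]mul1r !mulrDr !mul1r.
  rewrite -[sign_measure (B `|` C)]mul1r -[sign_measure B]mul1r -!mean_linear//.
  congr mean; apply/funext => s; rewrite !indicE !in_setU !in_setI.
  by case: (s \in B); case: (s \in C); lra.
- move=> B C BC; apply: mean_le => // s; rewrite !indicE ler_nat.
  have [sB|//] := boolP (s \in B); rewrite mem_set//.
  by apply: BC; exact: set_mem.
Qed.

End mean.

(** * Averaged functionals *)

Section rademacher.
Context {R : realType} {E : normedModType R}.
Context {U : set_system nat} {UU : UltraFilter U}.
Hypothesis ooU : \oo `<=` U.
Variables (e : nat -> E) (M : R) (phi : (nat -> bool) -> dual E).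
Hypothesis M0 : 0 < M.
Hypothesis e1 : forall n, `|e n| <= 1.
Hypothesis phiM : forall s, dual_bounded M (phi s).
Hypothesis phie : forall s n, sval (phi s) (e n) = sign_of R (s n).

Let m := @mean R U.
Let p (x : E) (s : nat -> bool) : R := sval (phi s) x.

Let bp x : bounded_on_signs (p x).
Proof. by exists (M * `|x|) => s; exact: phiM. Qed.

Let br n : bounded_on_signs (fun s => sign_of R (s n)).
Proof. exact: bounded_on_signs_sign. Qed.

Let bc (a : R) : bounded_on_signs (fun=> a).
Proof. exact: bounded_on_signs_cst. Qed.

Let bpr x n : bounded_on_signs (fun s => sign_of R (s n) * p x s).
Proof. exact: bounded_on_signsM. Qed.

Let bnp x : bounded_on_signs (fun s => `|p x s|).
Proof. exact: bounded_on_signs_norm. Qed.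

Definition mean_abs (x : E) : R := m (fun s => `|p x s|).

Lemma mean_abs_sub x y : `|mean_abs x - mean_abs y| <= mean_abs (x - y).
Proof.
have H z t : mean_abs z <= mean_abs (z - t) + mean_abs t.
  rewrite -[mean_abs (z - t)]mul1r -mean_linear//; apply: mean_le => //.
    by apply: bounded_on_signsD => //; apply: bounded_on_signsM.
  move=> s; rewrite mul1r (le_trans _ (ler_normD _ _))// /p dualB.
  by rewrite subrK.
have N z : mean_abs (- z) = mean_abs z.
  by congr m; apply/funext => s; rewrite /p dualN normrN.
have := H x y; have := H y x; rewrite -[mean_abs (y - x)]N opprB ler_norml.
by move=> H1 H2; apply/andP; split; lra.
Qed.

Lemma mean_abs0 : mean_abs 0 = 0.
Proof.
rewrite -[RHS](@mean_cst R U); congr m; apply/funext => s.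
by rewrite /p dual0 normr0.
Qed.

Lemma mean_abs_ge0 x : 0 <= mean_abs x.
Proof. by rewrite -(@mean_cst R U UU 0); apply: mean_le. Qed.

Definition half_diff n k : E := 2^-1 *: (e n - e k).

Lemma half_diff_le1 n k : `|half_diff n k| <= 1.
Proof.
rewrite normrZ ger0_norm// -ler_pdivlMl// invrK mulr1.
by rewrite (le_trans (ler_normB _ _))// -[2]/(1 + 1) lerD.
Qed.

(** For signs, [|s n - s k| / 2 = (1 - s n * s k) / 2], and orthogonality removes the product. *)
Lemma mean_abs_half_diff n k : n != k -> mean_abs (half_diff n k) = 2^-1.
Proof.
move=> nk; have m0 := @mean_signs R U UU ooU n k nk.
transitivity (m (fun s => - 2^-1 * (sign_of R (s n) * sign_of R (s k)) + 2^-1)).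
  congr m; apply/funext => s; rewrite /p /half_diff dualZ dualB !phie.
  case: (s n); case: (s k); rewrite /sign_of.
  - by rewrite subrr mulr0 normr0; lra.
  - by rewrite ger0_norm; lra.
  - by rewrite ler0_norm; lra.
  - by rewrite subrr mulr0 normr0; lra.
rewrite /m mean_linear//; last exact: bounded_on_signsM.
by rewrite m0 mulr0 add0r mean_cst.
Qed.

(** Each bounded sequence [f i (e n)] converges along [U], so two late indices give values within
    [2 * d] of each other for all [i < k]. *)
Lemma half_diff_adherent N :
  weakly_adherent [set half_diff nk.1 nk.2 | nk in
    [set nk : nat * nat | (N <= nk.1)%N && (nk.1 < nk.2)%N]] 0.
Proof.
move=> k f d d0.
have /choice[l fl] : forall i, exists l : R, sval (f i) (e n) @[n --> U] --> l.
  move=> i; have [K K0 fK] := dual_bound (f i).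
  suff /cvg_ex : cvg (sval (f i) (e n) @[n --> U]) by [].
  apply: (@ultra_cvg_bounded R nat U (fun n => sval (f i) (e n)) K) => n.
  by rewrite (le_trans (fK _))// ler_piMr// ltW.
have Ul : U [set n | forall i : 'I_k, `|sval (f i) (e n) - l i| < d].
  apply: filter_forall => i; have /cvgrPdist_lt/(_ _ d0) := fl i.
  by apply: filterS => n /=; rewrite distrC.
have tailU j : U [set n | (j <= n)%N] by apply: ooU; exists j.
have [n [/= Nn nl]] := filter_ex (filterI (tailU N) Ul).
have [n' [/= nn' nl']] := filter_ex (filterI (tailU n.+1) Ul).
exists (half_diff n n'); first by exists (n, n') => //=; rewrite Nn.
move=> i ik; rewrite subr0 /half_diff dualZ dualB normrM ger0_norm//.
rewrite -ltr_pdivlMl// invrK.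
have := ler_normB (sval (f i) (e n) - l i) (sval (f i) (e n') - l i).
have := nl (Ordinal ik); have := nl' (Ordinal ik) => /=.
have -> : sval (f i) (e n) - l i - (sval (f i) (e n') - l i) =
  sval (f i) (e n) - sval (f i) (e n') by rewrite opprB addrA subrK.
lra.
Qed.

Lemma mean_abs_weak_lim (b : nat -> E) x c : (forall n, `|b n - x| <= c) ->
  weak_lim b x -> mean_abs (b n - x) @[n --> \oo] --> (0 : R).
Proof.
move=> bxc bx; apply: contrapT => nq.
have [h h0 hn] : exists2 h : R, 0 < h & forall n, exists2 k, (n <= k)%N & h <= mean_abs (b k - x).
  apply: contrapT => nh; apply: nq; apply/cvgrPdist_lt => h h0.
  have [n nk] : exists n, forall k, (n <= k)%N -> mean_abs (b k - x) < h.
    apply: contrapT => nn; apply: nh; exists h => // n.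
    apply: contrapT => nk; apply: nn; exists n => k nk'.
    by rewrite ltNge; apply/negP => hk; apply: nk; exists k.
  exists n => // k /= /nk; by rewrite sub0r normrN ger0_norm// mean_abs_ge0.
have /choice[k /all_and2[nk hk]] : forall n, exists k, (n <= k)%N /\ h <= mean_abs (b k - x).
  by move=> n; have [k ? ?] := hn n; exists k.
pose y n := b (k n) - x.
have c0 : 0 <= c by exact: le_trans (bxc 0%N).
(* The added 1 makes [C] positive even if [c = 0], for the division below. *)
pose C := M * c + 1.
have C0 : 0 < C by rewrite ltr_wpDl// mulr_ge0// ltW.
have yC n s : `|p (y n) s| <= C.
  rewrite (le_trans (phiM _ _))// (le_trans (_ : _ <= M * c))//.
    by rewrite ler_wpM2l ?bxc// ltW.
  by rewrite lerDl.
pose A n := [set s | h / 2 <= `|p (y n) s|].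
(* Splitting the mean at [h / 2] gives [h <= C * sign_measure (A n) + h / 2], whence the lower bound
   [h / 2 / C]. *)
have [||i im iA] := @sign_measure_intersections R U UU A (h / 2 / C).
- by rewrite !divr_gt0.
- move=> n; rewrite ler_pdivrMr// mulrC.
  have bA : bounded_on_signs (\1_(A n) : _ -> R) by exact: bounded_on_signs_indic.
  have : mean_abs (y n) <= m (fun s => C * \1_(A n) s + h / 2).
    apply: mean_le => //.
      by apply: bounded_on_signsD => //; exact: bounded_on_signsM.
    move=> s; rewrite indicE; have [sA|nsA] := boolP (s \in A n).
      by rewrite mulr1 (le_trans (yC n s))// lerDl divr_ge0// ltW.
    rewrite mulr0 add0r leNgt; apply/negP => /ltW hs.
    by move/negP : nsA; apply; rewrite inE.
  rewrite /m mean_linear// mean_cst => /(le_trans (hk n)).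
  rewrite /sign_measure; lra.
have /choice[s sA] : forall n, exists s, forall j, (j < n)%N -> A (i j) s by exact: iA.
(* The functionals [phi (s n)] are large on ever more terms of the subsequence, so their limit [g]
   is large on all of them, against weak convergence. *)
have [g gM gs] := @dual_ulim R E nat U (fun n => phi (s n)) M UU (fun n => phiM (s n)).
have gy j : h / 2 <= `|sval g (y (i j))|.
  apply: (cvgr_to_ge (cvg_norm (gs _))); apply: ooU; exists j.+1 => // n /= jn.
  exact: sA.
have /cvgrPdist_lt/(_ (h / 2)) := bx g.
rewrite divr_gt0// => /(_ isT)[n _] /(_ (k (i n))) H.
have := gy n; rewrite leNgt => /negP; apply.
rewrite /y dualB distrC; apply: H => /=.
by rewrite (leq_trans (im n))//.
Qed.

Lemma mean_signs_sq n : m (fun s => sign_of R (s n) * sign_of R (s n)) = 1.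
Proof.
rewrite -[RHS](@mean_cst R U); congr m; apply/funext => s.
by rewrite /sign_of; case: ifP; rewrite ?mulrNN mulr1.
Qed.

Lemma rademacher_dual n : exists g : dual E,
  forall x, sval g x = m (fun s => sign_of R (s n) * p x s).
Proof.
have [||g _ gE] := @dual_of_linear R E (fun x => m (fun s => sign_of R (s n) * p x s)) M.
- move=> a x y; rewrite /m -mean_linear//; congr mean; apply/funext => s.
  by rewrite /p dualD dualZ mulrDr mulrCA.
- move=> x; have H s : `|sign_of R (s n) * p x s| <= M * `|x|.
    by rewrite normrM norm_sign_of mul1r; exact: phiM.
  rewrite ler_norml -{1}(@mean_cst R U UU (- _)) -{2}(@mean_cst R U UU (M * _)).
  by rewrite !mean_le// => s; have := H s; rewrite ler_norml => /andP[].
by exists g.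
Qed.

Definition rademacher n : dual E := projT1 (cid (rademacher_dual n)).

Lemma rademacherE n x : sval (rademacher n) x = m (fun s => sign_of R (s n) * p x s).
Proof. by rewrite /rademacher; case: cid => g /= ->. Qed.

Lemma rademacher_le n x : `|sval (rademacher n) x| <= mean_abs x.
Proof.
rewrite rademacherE ler_norml lerNl -[- m _]mulN1r -[- 1 * _]addr0.
rewrite -[0 in X in X && _](@mean_cst R U UU 0) -mean_linear//.
apply/andP; split; apply: mean_le => //.
- by apply: bounded_on_signsD => //; exact: bounded_on_signsM.
- move=> s; rewrite addr0 mulN1r (le_trans (ler_norm _))//.
  by rewrite normrN normrM norm_sign_of mul1r.
- by move=> s; rewrite (le_trans (ler_norm _))// normrM norm_sign_of mul1r.
Qed.

Lemma rademacher_half_diff n k : (n < k)%N ->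
  sval (rademacher k) (half_diff n k) = - 2^-1.
Proof.
move=> nk; rewrite /half_diff dualZ dualB !rademacherE.
have pe i : (fun s => sign_of R (s k) * p (e i) s) =
    (fun s => sign_of R (s k) * sign_of R (s i)).
  by apply/funext => s; rewrite /p phie.
rewrite !pe mean_signs_sq /m mean_signs//; last by rewrite neq_ltn nk orbT.
by rewrite sub0r mulrN1.
Qed.

(** The signs are orthonormal for the form [m (F * G)]. [psi n] is [p x] minus its projection on the
    first [n] signs, and its mean square is nonnegative. *)
Lemma bessel x N : \sum_(n < N) sval (rademacher n) x ^+ 2 <= (M * `|x|) ^+ 2.
Proof.
pose g n : R := sval (rademacher n) x.
pose psi := fix psi n : (nat -> bool) -> R :=
  if n is n'.+1 then fun s => - g n' * sign_of R (s n') + psi n' s else p x.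
have bpsi n : bounded_on_signs (psi n).
  elim: n => [|n IH]; first exact: bp.
  apply: bounded_on_signsD => //.
  exact: bounded_on_signsM.
have bpsir n k : bounded_on_signs (fun s => sign_of R (s k) * psi n s).
  exact: bounded_on_signsM.
have brr n k : bounded_on_signs (fun s => sign_of R (s k) * sign_of R (s n)).
  exact: bounded_on_signsM.
have psir n k : (n <= k)%N -> m (fun s => sign_of R (s k) * psi n s) = g k.
  elim: n k => [|n IH] k nk; first by rewrite /g rademacherE.
  transitivity (m (fun s => - g n * (sign_of R (s k) * sign_of R (s n)) +
      sign_of R (s k) * psi n s)).
    by congr m; apply/funext => s /=; rewrite mulrDr mulrCA.
  rewrite /m mean_linear// mean_signs//; last by rewrite neq_ltn nk orbT.
  by rewrite mulr0 add0r; exact: IH (ltnW nk).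
have psi2 n : m (fun s => psi n s * psi n s) =
    m (fun s => p x s * p x s) - \sum_(i < n) g i ^+ 2.
  elim: n => [|n IH]; first by rewrite big_ord0 subr0.
  have bpsi2 : bounded_on_signs (fun s => psi n s * psi n s).
    exact: bounded_on_signsM.
  have bg2 : bounded_on_signs (fun s => 1 * (psi n s * psi n s) + g n ^+ 2).
    by apply: bounded_on_signsD => //; exact: bounded_on_signsM.
  transitivity (m (fun s => - (2 * g n) * (sign_of R (s n) * psi n s) +
      (1 * (psi n s * psi n s) + g n ^+ 2))).
    congr m; apply/funext => s /=; rewrite /sign_of; case: ifP => _; lra.
  rewrite /m mean_linear// mean_linear// mean_cst -/m psir// IH.
  by rewrite big_ord_recr/=; lra.
have := psi2 N; have : 0 <= m (fun s => psi N s * psi N s).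
  rewrite -(@mean_cst R U UU 0); apply: mean_le => //.
    exact: bounded_on_signsM.
  by move=> s; exact: sqr_ge0.
have : m (fun s => p x s * p x s) <= (M * `|x|) ^+ 2.
  rewrite -[leRHS](@mean_cst R U UU); apply: mean_le => //.
    exact: bounded_on_signsM.
  move=> s; rewrite -expr2 -real_normK ?num_real//.
  by rewrite lerXn2r// ?nnegrE ?mulr_ge0 ?normr_ge0 ?(ltW M0)//; exact: phiM.
by rewrite /g; lra.
Qed.

Lemma rademacher_cvg0 x : sval (rademacher n) x @[n --> \oo] --> (0 : R).
Proof.
suff sq0 : (sval (rademacher n) x : R) ^+ 2 @[n --> \oo] --> (0 : R).
  apply/cvgrPdist_lt => d d0.
  have /cvgrPdist_lt/(_ (d ^+ 2)) := sq0; rewrite exprn_gt0// => /(_ isT).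
  apply: filterS => n; rewrite !sub0r !normrN normrX.
  by rewrite ltr_pXn2r// nnegrE ltW.
pose u (n : nat) : R := sval (rademacher n) x ^+ 2.
suff cu : cvgn (series u) by exact: (@cvg_series_cvg_0 R R^o u cu).
apply: nondecreasing_is_cvgn.
  by apply: nondecreasing_series => n _ _; exact: sqr_ge0.
exists ((M * `|x|) ^+ 2) => _ [N _ <-].
by rewrite /series/= big_mkord; exact: bessel.
Qed.

End rademacher.

(** * The weak unit ball *)

Lemma cvg_set_type {X : topologicalType} (A : set X) (F : set_system A) (x : A) :
  Filter F -> set_val y @[y --> F] --> set_val x -> F --> x.
Proof.
move=> FF cF W [_ [[V oV <-] Vx VW]].
by apply: filterS VW _; apply: cF; exact: open_nbhs_nbhs.
Qed.

(** An ultrafilter on this set either contains every tail together with [x], and tends to [x], or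
    concentrates on a finite initial part. *)
Lemma compact_cvg_seq {X : topologicalType} (u : nat -> X) (x : X) :
  u @ \oo --> x -> compact (range u `|` [set x]).
Proof.
move=> ux; rewrite compact_ultra => F FU Fux.
pose tail N := [set u n | n in [set n | (N <= n)%N]].
have [tF|/existsNP[N nN]] :=
  pselect (forall N, F (tail N `|` [set x])).
  exists x; split; first by right.
  move=> W /[dup] Wx /ux[N _ NW]; apply: filterS (tF N) => _ [[n /= Nn <-]|->].
    exact: NW.
  exact: nbhs_singleton.
have [//|FN] := in_ultra_setVsetC (tail N `|` [set x]) FU.
have : compact (u @` `I_N) by apply: finite_compact; exact: finite_image.
rewrite compact_ultra => /(_ F FU)[|y [[n _ <-] uy]]; last first.
  by exists (u n); split => //; left; exists n.
apply: filterS2 Fux FN => y [[n _ <-]|->] ny; last by exfalso; apply: ny; right.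
exists n => //=; rewrite ltnNge; apply/negP => Nn; apply: ny; left.
by exists n.
Qed.

(** Turns a failure of continuity into a closure point, to which Frechet-Urysohn or the weak
    dichotomy applies. *)
Lemma not_cvg_closure {X : topologicalType} {R : realType} (h : X -> R) (x : X)
    (B : set X) : ~ (h @ within B (nbhs x) --> h x) ->
  exists2 d : R, 0 < d & closure (B `&` [set y | d <= `|h y - h x|]) x.
Proof.
move=> nh; apply: contrapT => nd; apply: nh; apply/cvgrPdist_lt => d d0.
apply: contrapT => nB; apply: nd; exists d => // W Wx.
apply: contrapT => nW; apply: nB; rewrite near_withinE.
apply: filterS Wx => y Wy By; rewrite ltNge; apply/negP => dy; apply: nW.
by exists y; split => //; split => //=; rewrite distrC.
Qed.

Section weak_ball.
Context {R : realType} {E : normedModType R}.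
Local Notation ball_w := (unit_ball_w E).
Implicit Types (z : ball_w) (A : set ball_w) (f : dual E).

Definition ball_val z : E := set_val z.

Definition ball_of (x : E) (x1 : `|x| <= 1) : ball_w :=
  exist _ x (mem_set x1).

Lemma ball_val_le1 z : `|ball_val z| <= 1.
Proof. exact: (set_valP z). Qed.

Lemma cvg_ball_w (F : set_system ball_w) z : Filter F ->
  F --> z <-> forall f, sval f (ball_val y) @[y --> F] --> sval f (ball_val z).
Proof.
move=> FF; split=> [Fz|Fz].
  apply/(@cvg_weakP R E (ball_val @ F)).
  by apply: cvg_comp Fz _; exact: (@initial_continuous ball_w (weak_space E) set_val z).
apply: cvg_set_type; exact/(@cvg_weakP R E (ball_val @ F)).
Qed.

Lemma cvg_ball_w_seq (b : nat -> ball_w) z :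
  b @ \oo --> z <-> weak_lim (ball_val \o b) (ball_val z).
Proof. by rewrite cvg_ball_w. Qed.

Lemma continuous_dual_ball f : continuous (fun z => sval f (ball_val z) : R).
Proof.
by move=> z; have /cvg_ball_w : nbhs z --> z by []; exact.
Qed.

Lemma closure_weakly_adherent A z :
  closure A z -> weakly_adherent (ball_val @` A) (ball_val z).
Proof.
move=> Az k f d d0.
have : \forall y \near z, forall i : 'I_k,
    `|sval (f i) (ball_val y) - sval (f i) (ball_val z)| < d.
  apply: (@filter_forall _ _ (fun (i : 'I_k) y =>
    `|sval (f i) (ball_val y) - sval (f i) (ball_val z)| < d) (nbhs z)) => i.
  have /cvgrPdist_lt/(_ _ d0) := @continuous_dual_ball (f i) z.
  by apply: filterS => y /=; rewrite distrC.
move=> /Az[y [Ay yd]]; exists (ball_val y); first by exists y.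
by move=> i ik; rewrite dualB; exact: (yd (Ordinal ik)).
Qed.

Lemma weakly_adherent_closure A z :
  weakly_adherent (ball_val @` A) (ball_val z) -> closure A z.
Proof.
move=> /weakly_adherent_countable[b bA /weakly_adherent_ultra[U UU bU]].
have /choice[y /all_and2[Ay yb]] : forall n, exists y, A y /\ ball_val y = b n.
  by move=> n; have [y ? ?] := bA n; exists y.
have yz : y @ U --> z.
  apply/cvg_ball_w => f.
  have : sval f (ball_val (y n)) @[n --> U] --> sval f (ball_val z).
    by under eq_cvg do rewrite yb; exact: bU.
  exact.
by move=> W /yz yW; have [n Wn] := @filter_ex _ U _ _ yW; exists (y n).
Qed.

Lemma hausdorff_ball_w : hausdorff_space ball_w.
Proof.
move=> x y xy; apply: val_inj; apply/eqP; rewrite -subr_eq0; apply/negP => /negP.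
move=> /(@dual_separating R E)[f]; rewrite dualB => /eqP; apply; apply/eqP.
rewrite subr_eq0; apply/eqP; apply: (@norm_hausdorff R R^o) => A B Ax By.
have [z [Az Bz]] := xy _ _ (@continuous_dual_ball f x _ Ax) (@continuous_dual_ball f y _ By).
by exists (sval f (ball_val z)).
Qed.

Lemma tychonoff_ball_w : tychonoff_space ball_w.
Proof. by split; [exact: uniform_completely_regular|exact: hausdorff_ball_w]. Qed.

End weak_ball.

(** * Frechet-Urysohn spaces *)

Definition frechet_urysohn (Z : topologicalType) : Prop :=
  forall (A : set Z) (z : Z), closure A z ->
  exists2 b : nat -> Z, (forall n, A (b n)) & b @ \oo --> z.

Section compact_open.
Context {R : realType} {Z : topologicalType}.

Definition Ck_val (g : Ck R Z) : Z -> R := set_val g.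

Lemma Ck_val_continuous (g : Ck R Z) : continuous (Ck_val g).
Proof. exact: (set_valP g). Qed.

(** The compact-open topology agrees with uniform convergence on compacta at a continuous limit,
    which membership in [Ck] provides. *)
Lemma cvg_CkP (F : set_system (Ck R Z)) (g : Ck R Z) : Filter F ->
  F --> g <-> forall (C : set Z) (d : R), compact C -> 0 < d ->
    \forall h \near F, forall y, C y -> `|Ck_val g y - Ck_val h y| < d.
Proof.
move=> FF; split=> [Fg C d Cc d0|Fg].
  have : {compact-open, Ck_val @ F --> Ck_val g}.
    by apply: cvg_comp Fg _; exact: (@initial_continuous (Ck R Z) {compact-open, Z -> R} set_val g).
  move/(compact_open_fam_compactP (@Ck_val_continuous g) _).
  move=> /fam_cvgP/(_ C Cc)/(_ [set h | forall y, C y -> ball (Ck_val g y) d (h y)]).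
  apply; apply/uniform_nbhs; exists [set xy | ball xy.1 d xy.2].
  by split => //; exact: entourage_ball (PosNum d0).
apply: cvg_set_type.
have : {family compact, Ck_val @ F --> Ck_val g}.
  apply/fam_cvgP => C Cc P /uniform_nbhs[D [entD DP]].
  have [d /= d0 dD] := entD.
  apply: filterS (Fg C d Cc d0) => h hC; apply: DP => y Cy.
  by apply: dD; exact: hC.
by move=> /(compact_open_fam_compactP (@Ck_val_continuous g) _).
Qed.

End compact_open.

Section frechet_urysohn.
Context {R : realType} {Z : topologicalType}.

Lemma frechet_urysohn_seq_continuous (f : Z -> R) : frechet_urysohn Z ->
  seq_continuous f -> continuous f.
Proof.
move=> FU sf z; apply: contrapT => nz.
have : ~ (f @ within setT (nbhs z) --> f z).
  by move=> H; apply: nz => W /H; apply: (@filterS _ (nbhs z)) => y; exact.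
move=> /not_cvg_closure[d d0 /FU[b bd /sf]].
move=> /cvgrPdist_lt/(_ d d0)[N _ /(_ N (leqnn N))] /=.
by rewrite distrC ltNge (bd N).2.
Qed.

(** A convergent sequence with its limit is compact, so continuity on compacta implies sequential
    continuity. *)
Lemma seq_continuous_kR_space :
  (forall f : Z -> R, seq_continuous f -> continuous f) -> kR_space R Z.
Proof.
move=> sc f; split=> [cf K _|Kf]; first exact: continuous_subspaceT.
apply: sc => u x ux.
pose C := range u `|` [set x].
have /subspace_continuousP/(_ x (or_intror erefl)) : {within C, continuous f}.
  by apply: Kf; exact: compact_cvg_seq ux.
apply: cvg_comp => W Wx.
have uW : \forall n \near \oo, C (u n) -> W (u n) := ux _ Wx.
by apply: filterS uW => n; apply; left; exists n.
Qed.

(** [K] is even equicontinuous at [z]. Otherwise some [b n] tend to [z] while [g n] in [K] varies by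
    [d / 2] between [b n] and [z]; a limit [h] of the [g n] is approached uniformly on the compact
    set of the [b n] and [z], against continuity of [h]. *)
Lemma frechet_urysohn_evenly_continuous (K : set (Ck R Z)) : frechet_urysohn Z ->
  compact K -> evenly_continuous K.
Proof.
move=> FU Kc; apply/evenly_continuousP => z f Kf O /nbhs_ballP[d /= d0 dO].
have d20 : 0 < d / 2 by rewrite divr_gt0.
pose A := [set y | exists2 g, K g & d / 2 <= `|Ck_val g y - Ck_val g z|].
have /existsNP[V /not_implyP[Vz AV]] : ~ closure A z.
  move=> /FU[b bA bz].
  have /choice[g /all_and2[Kg gb]] : forall n, exists g,
      K g /\ d / 2 <= `|Ck_val g (b n) - Ck_val g z|.
    by move=> n; have [g ? ?] := bA n; exists g.
  have [U [UU ooU]] := ultraFilterLemma eventually_filter.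
  move: Kc; rewrite compact_ultra => /(_ _ (ultra_fmap g UU))[|h [_ gh]].
    by apply: (@filterE _ U) => n; exact: Kg.
  (* Three errors below [d / 8] will add up to less than [d / 2]. *)
  have d80 : 0 < d / 8 by rewrite divr_gt0.
  have gU : U [set n | forall y, (range b `|` [set z]) y ->
      `|Ck_val h y - Ck_val (g n) y| < d / 8].
    by move: gh => /cvg_CkP; apply; [exact: compact_cvg_seq|].
  have hz : Ck_val h (b n) @[n --> \oo] --> Ck_val h z.
    by apply: cvg_comp bz _; exact: Ck_val_continuous.
  have /cvgrPdist_lt/(_ _ d80)/ooU hU := hz.
  have [n [/= gn hn]] := filter_ex (filterI gU hU).
  have := gb n; have := gn (b n) (or_introl (imageT b n)).
  have := gn z (or_intror erefl); move: hn.
  rewrite ler_normr !ltr_norml => /andP[? ?] /andP[? ?] /andP[? ?] /orP[?|?]; lra.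
exists [set g | `|Ck_val f z - Ck_val g z| < d / 2], V; split => //.
  have /cvg_CkP/(_ [set z] (d / 2)) : nbhs f --> f by [].
  move=> /(_ (@compact_set1 _ z) d20); apply: filterS => g; exact.
move=> g y [Kg gf] Vy; apply: dO; rewrite /ball/= /Ck_eval/=.
rewrite [X in `|X|](_ : _ = (Ck_val f z - Ck_val g z) - (Ck_val g y - Ck_val g z)).
  rewrite (le_lt_trans (ler_normB _ _))// [ltRHS]splitr ltrD//.
  rewrite ltNge; apply/negP => dy; apply: AV; exists y; split => //.
  by exists g.
by rewrite opprB addrA subrK.
Qed.

End frechet_urysohn.

(** * The equivalences *)

Lemma no_ell1_frechet_urysohn {R : realType} (E : completeNormedModType R) :
  ~ contains_isomorphic_copy (ell1 R) E -> frechet_urysohn (unit_ball_w E).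
Proof.
move=> nE A z /closure_weakly_adherent/weak_dichotomy[[b bA bz]|[b bA]].
  have /choice[y /all_and2[Ay yb]] : forall n, exists y, A y /\ ball_val y = b n.
    by move=> n; have [y ? ?] := bA n; exists y.
  exists y => //; apply/cvg_ball_w_seq.
  by rewrite (_ : _ \o _ = b)//; apply/funext.
move=> indb; exfalso; apply: nE.
apply: (@independent_contains_ell1 R E b (ball_val z) 2 _ indb) => n.
have [y _ <-] := bA n.
by rewrite (le_trans (ler_normB _ _))// -[2]/(1 + 1) lerD// ball_val_le1.
Qed.

(** * Failure of the three topological properties in the presence of sign functionals *)

Section ball_of_space_with_ell1.
Context {R : realType} {E : normedModType R}.
Context {U : set_system nat} {UU : UltraFilter U}.
Hypothesis ooU : \oo `<=` U.
Variables (e : nat -> E) (M : R) (phi : (nat -> bool) -> dual E).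
Hypothesis M0 : 0 < M.
Hypothesis e1 : forall n, `|e n| <= 1.
Hypothesis phiM : forall s, dual_bounded M (phi s).
Hypothesis phie : forall s n, sval (phi s) (e n) = sign_of R (s n).
Local Notation ball_w := (unit_ball_w E).

Let norm0_le1 : `|0 : E| <= 1. Proof. by rewrite normr0 ler01. Qed.
Let zero_ball : ball_w := ball_of norm0_le1.
Let half_ball n k : ball_w := ball_of (half_diff_le1 e1 n k).
Let g := @rademacher R E U UU M phi phiM.
Let ball_abs (z : ball_w) : R := @mean_abs R E U phi (ball_val z).

Let half_ball_near (W : set ball_w) N : nbhs zero_ball W ->
  exists n k, [/\ (N <= n)%N, (n < k)%N & W (half_ball n k)].
Proof.
move=> W0; pose A := [set half_ball nk.1 nk.2 | nk in
  [set nk : nat * nat | (N <= nk.1)%N && (nk.1 < nk.2)%N]].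
have /(_ W W0)[_ [[[n k] /andP[/= Nn nk] <-] Wnk]] : closure A zero_ball.
  apply: weakly_adherent_closure => l f d d0.
  have [_ [nk nkN <-] nkd] := half_diff_adherent ooU e1 N l f d0.
  by exists (half_diff e nk.1 nk.2) => //; exists (half_ball nk.1 nk.2) => //; exists nk.
by exists n, k.
Qed.

Let ball_abs_not_continuous : ~ {for zero_ball, continuous ball_abs}.
Proof.
have h0 : 0 < 2^-1 :> R by rewrite invr_gt0.
move=> /cvgrPdist_lt/(_ _ h0)/(half_ball_near 0)[n [k [_ nk]]].
rewrite /ball_abs /ball_val /= mean_abs0 (mean_abs_half_diff ooU phie)//; last by rewrite neq_ltn nk.
by rewrite sub0r normrN gtr0_norm ?ltxx ?invr_gt0.
Qed.

Let ball_dist2 (x y : ball_w) : `|ball_val x - ball_val y| <= 2.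
Proof.
by rewrite (le_trans (ler_normB _ _))// -[2]/(1 + 1) lerD// ball_val_le1.
Qed.

Lemma ball_abs_seq_continuous : seq_continuous ball_abs.
Proof.
move=> u z /cvg_ball_w_seq uz; apply/cvgrPdist_le => d d0.
have := mean_abs_weak_lim (UU := UU) ooU M0 phiM (fun n => ball_dist2 (u n) z) uz.
move=> /cvgrPdist_le/(_ d d0); apply: filterS => n /=.
rewrite sub0r normrN ger0_norm ?(mean_abs_ge0 phiM)//.
by apply: le_trans; rewrite distrC; exact: (mean_abs_sub phiM).
Qed.

Lemma not_seq_continuous_continuous :
  ~ forall f : ball_w -> R, seq_continuous f -> continuous f.
Proof.
by move=> /(_ _ ball_abs_seq_continuous) c; exact/ball_abs_not_continuous/c.
Qed.

(** [ball_abs] is continuous on every compact [K]: at a discontinuity the dichotomy yields a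
    convergent sequence, against sequential continuity, or an independent one in [K], against
    compactness. *)
Lemma not_kR_space_ball : ~ kR_space R ball_w.
Proof.
move=> /(_ ball_abs)[_ kR]; apply: ball_abs_not_continuous; apply: kR => K Kc.
apply/subspace_continuousP => x Kx; apply: contrapT.
move=> /not_cvg_closure[d d0 /closure_weakly_adherent/weak_dichotomy[]].
  move=> [b bA bx].
  have /choice[y /all_and2[Ay yb]] : forall n, exists y,
      (K y /\ d <= `|ball_abs y - ball_abs x|) /\ ball_val y = b n.
    by move=> n; have [y ? ?] := bA n; exists y.
  have yx : y @ \oo --> x.
    by apply/cvg_ball_w_seq; rewrite (_ : _ \o _ = b)//; apply/funext.
  have /cvgrPdist_lt/(_ d d0)[N _ /(_ N (leqnn N))] := ball_abs_seq_continuous yx.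
  by rewrite /= distrC ltNge (Ay N).2.
move=> [b bA]; apply: (@independent_not_compact R E (ball_val @` K)).
  apply: (@continuous_compact ball_w (weak_space E)) => //.
  by apply: continuous_subspaceT; exact: initial_continuous.
by move=> n; have [y [Ky _] <-] := bA n; exists y.
Qed.

(** Otherwise [g k] stays at least [d] in absolute value at points [y] of [C] for arbitrarily large
    [k]. Independence being excluded on [C], a subsequence of these points tends weakly to some [x],
    and [|g k y| <= mean_abs (y - x) + |g k x|] tends to 0. *)
Lemma rademacher_compact_cvg (C : set ball_w) (d : R) : compact C -> 0 < d ->
  \forall n \near \oo, forall y, C y -> `|sval (g n) (ball_val y)| < d.
Proof.
move=> Cc d0; apply: contrapT => nN.
have /choice[k /choice[y ky]] : forall N, exists k y,
    [/\ (N <= k)%N, C y & d <= `|sval (g k) (ball_val y)|].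
  move=> N; apply: contrapT => nk; apply: nN; exists N => // k Nk y Cy.
  by rewrite ltNge; apply/negP => dk; apply: nk; exists k, y.
have := Cc; rewrite compact_ultra => /(_ _ (ultra_fmap y UU))[|x [Cx yx]].
  by apply: (@filterE _ U) => n; have [] := ky n.
have {}yx (f : dual E) : sval f (ball_val (y n)) @[n --> U] --> sval f (ball_val x).
  by move: yx => /cvg_ball_w; exact.
(* The constraint gives [i <= m i], so that [k (m i)] tends to infinity. *)
have [i|[m im mx]|[m]] := @ultra_weak_dichotomy R E (ball_val \o y) (ball_val x)
    U (fun i => [set n | (i <= n)%N]) UU yx.
- by apply: ooU; exists i.
- have d20 : 0 < d / 2 by rewrite divr_gt0.
  have gx : sval (g (k (m i))) (ball_val x) @[i --> \oo] --> (0 : R).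
    have := @rademacher_cvg0 R E U UU ooU M phi M0 phiM (ball_val x).
    apply: cvg_comp => W [N _ NW]; exists N => // i /= Ni; apply: NW => /=.
    have [+ _ _] := ky (m i); apply: leq_trans.
    exact: leq_trans Ni (im i).
  have yq := mean_abs_weak_lim (UU := UU) ooU M0 phiM (fun i => ball_dist2 (y (m i)) x) mx.
  have /cvgrPdist_lt/(_ _ d20) gx' := gx.
  have /cvgrPdist_lt/(_ _ d20) yq' := yq.
  have [i [/=]] := filter_ex (filterI gx' yq').
  rewrite !sub0r !normrN => gd /(le_lt_trans (ler_norm _)) qd.
  have [_ _] := ky (m i); rewrite leNgt => /negP; apply.
  rewrite -[ball_val (y (m i))](subrK (ball_val x)) dualD.
  rewrite (le_lt_trans (ler_normD _ _))// [ltRHS]splitr ltrD//.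
  exact: le_lt_trans (rademacher_le _ _ _) qd.
apply: (@independent_not_compact R E (ball_val @` C)).
  apply: (@continuous_compact ball_w (weak_space E)) => //.
  by apply: continuous_subspaceT; exact: initial_continuous.
by move=> n /=; have [_ Cy _] := ky (m n); exists (y (m n)).
Qed.

Let dual_Ck (f : dual E) : Ck R ball_w :=
  exist _ (fun z => sval f (ball_val z)) (mem_set (@continuous_dual_ball R E f)).

(** The [g n] and their limit 0 form a compact set. Every neighbourhood of 0 in the ball contains
    some [half_ball n k] with [n < k] and [k] large, where [g k] is [- 2^-1]. *)
Lemma not_ascoli_space_ball : ~ ascoli_space R ball_w.
Proof.
have [zero _ zeroE] := @zero_dual R E.
have CkE (f : dual E) y : Ck_val (dual_Ck f) y = sval f (ball_val y) by [].
pose u n := dual_Ck (g n).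
have u0 : u @ \oo --> dual_Ck zero.
  apply/cvg_CkP => C d Cc d0; apply: filterS (rademacher_compact_cvg Cc d0) => n nC y Cy.
  by rewrite !CkE zeroE sub0r normrN nC.
move=> [_ /(_ _ (compact_cvg_seq u0))/evenly_continuousP].
move=> /(_ zero_ball (dual_Ck zero) (or_intror erefl) (ball 0 2^-1)).
case; first by rewrite /Ck_eval -/(Ck_val _) CkE zeroE; apply: nbhsx_ballx; rewrite invr_gt0.
move=> W [V [/u0[N _ NW] V0 WV]].
have [n [k [Nn nk Vnk]]] := half_ball_near N V0.
have : ball (0 : R) 2^-1 (Ck_eval (half_ball n k, u k)).
  by apply: WV Vnk; split; [left; exists k|apply: NW; exact: leq_trans Nn (ltnW nk)].
rewrite /ball /= /Ck_eval -/(Ck_val _) CkE (rademacher_half_diff ooU phiM phie nk).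
by rewrite sub0r opprK gtr0_norm ?ltxx ?invr_gt0.
Qed.

End ball_of_space_with_ell1.

Lemma ell1_ball {R : realType} {E : completeNormedModType R} :
  contains_isomorphic_copy (ell1 R) E ->
  [/\ ~ ascoli_space R (unit_ball_w E), ~ kR_space R (unit_ball_w E) &
      ~ forall f : unit_ball_w E -> R, seq_continuous f -> continuous f].
Proof.
move=> /ell1_copy_signs[e [M [M0 e1 /(_ _)/cid2-/all_sig2[phi phiM phie]]]].
have [U [UU ooU]] := ultraFilterLemma eventually_filter.
split.
- exact: (not_ascoli_space_ball ooU M0 e1 phiM phie).
- exact: (not_kR_space_ball ooU M0 e1 phiM phie).
- exact: (not_seq_continuous_continuous ooU M0 e1 phiM phie).
Qed.

Theorem theorem1p9 (R : realType) (E : completeNormedModType R) :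
  [<-> ascoli_space R (unit_ball_w E);
       kR_space R (unit_ball_w E);
       forall f : unit_ball_w E -> R, seq_continuous f -> continuous f;
       ~ contains_isomorphic_copy (ell1 R) E].
Proof.
have FUseq : ~ contains_isomorphic_copy (ell1 R) E ->
    forall f : unit_ball_w E -> R, seq_continuous f -> continuous f.
  move=> /no_ell1_frechet_urysohn FU f.
  exact: frechet_urysohn_seq_continuous FU.
have FUkR nE := seq_continuous_kR_space (FUseq nE).
tfae.
(* The first two implications pass through the absence of l1, which each property forces by
   [ell1_ball]. *)
- by move=> H; apply: FUkR => /ell1_ball[].
- by move=> H; apply: FUseq => /ell1_ball[].
- by move=> H /ell1_ball[].
- move=> nE; split; first exact: tychonoff_ball_w.
  move=> K; apply: frechet_urysohn_evenly_continuous.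
  exact: no_ell1_frechet_urysohn.
Qed.
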